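(* Let $p \in [1, \infty)$, let $G$ be a second countable locally compact group, and let $(G, A, \alpha)$ be an isometric $G$-$L^p$ operator algebra such that $A$ is nondegenerately $\sigma$-finitely representable. Then: (1) There is a homomorphism $\iota \colon C_{\mathrm c}(G, A, \alpha) \to F^p(G, A, \alpha)$ such that whenever $(X, \mathcal B, \mu)$ is a $\sigma$-finite measure space and $(v, \pi)$ is a nondegenerate contractive covariant representation of $(G, A, \alpha)$ on $L^p(X, \mu)$, there is a unique contractive representation $\rho_{v, \pi} \colon F^p(G, A, \alpha) \to L(L^p(X, \mu))$ such that $\rho_{v, \pi} \circ \iota = v \ltimes \pi$. (2) For every $a \in F^p(G, A, \alpha)$, we have $\|a\| = \sup \|\rho_{v, \pi}(a)\|$, the supremum being over all nondegenerate $\sigma$-finite contractive covariant representations $(v, \pi)$ of $(G, A, \alpha)$. (3) The homomorphism $\iota$ of (1) has dense range.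
   Context: $L(E)$ is the algebra of bounded operators on a Banach space $E$. An $L^p$ operator algebra is a Banach algebra (not necessarily unital) isometrically isomorphic to a norm closed subalgebra of $L(L^p(X,\mu))$ for some measure space $(X,\mathcal B,\mu)$. A representation of $A$ on $L^p(X,\mu)$ is a continuous homomorphism $\pi\colon A\to L(L^p(X,\mu))$; it is contractive if $\|\pi(a)\|\le\|a\|$ for all $a$, isometric if $\|\pi(a)\|=\|a\|$ for all $a$, $\sigma$-finite if $\mu$ is $\sigma$-finite, and nondegenerate if the span of $\{\pi(a)\xi\}$ is dense. $A$ is nondegenerately $\sigma$-finitely representable if it has a nondegenerate $\sigma$-finite isometric representation. An isometric $G$-$L^p$ operator algebra $(G,A,\alpha)$ is an $L^p$ operator algebra $A$ with a homomorphism $g\mapsto\alpha_g$ from $G$ to the group of isometric automorphisms of $A$ such that $g\mapsto\alpha_g(a)$ is continuous for every $a\in A$. A covariant representation of $(G,A,\alpha)$ on $L^p(X,\mu)$ is a pair $(v,\pi)$ of a representation $g\mapsto v_g$ of $G$ by invertible bounded operators on $L^p(X,\mu)$, with $g\mapsto v_g\xi$ continuous for all $\xi$, and a representation $\pi$ of $A$ on $L^p(X,\mu)$, with $\pi(\alpha_g(a))=v_g\pi(a)v_g^{-1}$ for all $g\in G$, $a\in A$. It is contractive if $\|v_g\|\le 1$ for all $g$ and $\pi$ is contractive; it is nondegenerate or $\sigma$-finite if $\pi$ is. $\nu$ is a left Haar measure on $G$. $C_{\mathrm c}(G,A,\alpha)$ is the space of compactly supported continuous functions $G\to A$ with product $(ab)(g)=\int_G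 a(h)\alpha_h(b(h^{-1}g))\,d\nu(h)$. For a covariant representation $(v,\pi)$, $v\ltimes\pi$ is the representation of $C_{\mathrm c}(G,A,\alpha)$ given by $(v\ltimes\pi)(a)\xi=\int_G\pi(a(g))v_g\xi\,d\nu(g)$. The full $L^p$ operator crossed product $F^p(G,A,\alpha)$ is the Hausdorff completion of $C_{\mathrm c}(G,A,\alpha)$ in the seminorm $a\mapsto\sup\|(v\ltimes\pi)(a)\|$, the supremum being over all nondegenerate $\sigma$-finite contractive covariant representations $(v,\pi)$ of $(G,A,\alpha)$ (on $L^p$ spaces). *)

(* Defs.v *)
From HB Require Import structures.
From mathcomp Require Import all_boot all_order all_algebra monoid.
From mathcomp Require Import complex generic_quotient.
From mathcomp Require Import all_classical all_reals all_analysis.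
From mathcomp Require Import measurable_realfun.

Set Implicit Arguments.
Unset Strict Implicit.
Unset Printing Implicit Defensive.

Import Order.TTheory GRing.Theory Num.Theory.
Import numFieldNormedType.Exports.
Import Normc.

Local Open Scope classical_set_scope.
Local Open Scope ring_scope.
Local Open Scope complex_scope.
Local Open Scope quotient_scope.

HB.mixin Record NormedModule_isNormedAlgebra (K : numFieldType) A
    & NormedModule K A := {
  nmul : A -> A -> A;
  nmulA : associative nmul;
  nmulDl : left_distributive nmul +%R;
  nmulDr : right_distributive nmul +%R;
  nmulZl : forall (k : K) a b, nmul (k *: a) b = k *: nmul a b;
  nmulZr : forall (k : K) a b, nmul a (k *: b) = k *: nmul a b;
  ler_normM : forall a b : A, `|nmul a b| <= `|a| * `|b|
}.

(* not necessarily unital *)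
#[short(type="normedAlgType")]
HB.structure Definition NormedAlgebra (K : numFieldType) :=
  {A of NormedModule K A & NormedModule_isNormedAlgebra K A}.

#[short(type="banachAlgType")]
HB.structure Definition BanachAlgebra (K : numFieldType) :=
  {A of NormedAlgebra K A & Complete A}.

HB.mixin Record PointedTopological_isTopologicalGroup G
    & PointedTopological G & Group G := {
  mulg_continuous : continuous (fun x : G * G => (x.1 * x.2)%g);
  invg_continuous : continuous (fun x : G => x^-1%g)
}.

#[short(type="topologicalGroupType")]
HB.structure Definition TopologicalGroup :=
  {G of PointedTopological G & Group G & PointedTopological_isTopologicalGroup G}.

Section real_norm.
Context {R : realType} {E : normedModType R[i]}.

(* In a normed module over R[i] the norm is R[i]-valued; nrm is the same
   number, seen in R. *)
Definition nrm (x : E) : R := complex.Re `|x|.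

Lemma nrmE (x : E) : `|x| = (nrm x)%:C.
Proof.
have := normr_ge0 x; rewrite lecE/= => /andP[/eqP h _].
by rewrite /nrm; move: h; case: `|x| => a b /= ->.
Qed.

End real_norm.
Lemma normc_ge0 {R : rcfType} (c : R[i]) : 0 <= normc c.
Proof. by case: c => a b; exact: sqrtr_ge0. Qed.

Section nrm_lemmas.
Context {R : realType} {E : normedModType R[i]}.
Implicit Types x y : E.

Lemma nrm_ge0 x : 0 <= nrm x.
Proof. by rewrite -ler0c -nrmE. Qed.

Lemma nrm0 : nrm (0 : E) = 0.
Proof. by rewrite /nrm normr0. Qed.

Lemma nrm0_eq0 x : nrm x = 0 -> x = 0.
Proof. by move=> x0; apply: normr0_eq0; rewrite nrmE x0. Qed.

Lemma ler_nrmD x y : nrm (x + y) <= nrm x + nrm y.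
Proof. by rewrite -lecR rmorphD/= -!nrmE ler_normD. Qed.

Lemma nrmZ (c : R[i]) x : nrm (c *: x) = normc c * nrm x.
Proof. by apply: complexI; rewrite rmorphM/= -!nrmE normrZ. Qed.

Lemma nrmN x : nrm (- x) = nrm x.
Proof. by rewrite /nrm normrN. Qed.

End nrm_lemmas.

Section bounded_operators.
Context {R : realType}.

Definition bounded_linear (E : normedModType R[i]) (T : E -> E) :=
  linear T /\ exists M : R, forall x, nrm (T x) <= M * nrm x.

Definition opnorm (E : normedModType R[i]) (T : E -> E) : R :=
  sup [set nrm (T x) | x in [set x | nrm x <= 1]].

Definition bounded_linear_pred (E : normedModType R[i]) : {pred E -> E} :=
  mem [set T | @bounded_linear E T].

Record bop (E : normedModType R[i]) :=
  Bop { bop_fun :> E -> E; bop_subproof : bop_fun \in @bounded_linear_pred E }.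

Section bop_structure.
Variable E : normedModType R[i].
Implicit Types S T : bop E.

HB.instance Definition _ := [isSub for @bop_fun E].
HB.instance Definition _ := [Choice of bop E by <:].

Lemma bounded_linear_submod : submod_closed (@bounded_linear_pred E).
Proof.
split.
  rewrite inE; split; first by move=> c x y; rewrite /= scaler0 addr0.
  by exists 0 => x; rewrite nrm0 mul0r.
move=> c S T /[!inE] -[lS [MS bS]] [lT [MT bT]]; split.
  move=> k x y; rewrite !fctE /= lS lT !scalerDr !scalerA mulrC.
  by rewrite addrACA.
exists (normc c * MS + MT) => x; rewrite !fctE/=.
apply: (le_trans (ler_nrmD _ _)); rewrite mulrDl lerD// nrmZ -mulrA.
by rewrite ler_wpM2l// normc_ge0.
Qed.

HB.instance Definition _ :=
  GRing.isSubmodClosed.Build _ _ (@bounded_linear_pred E) bounded_linear_submod.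
HB.instance Definition _ := [SubChoice_isSubLmodule of bop E by <:].

Lemma bopP T : bounded_linear T.
Proof. by have := bop_subproof T; rewrite inE. Qed.

Lemma bopD_fun S T x : (S + T) x = S x + T x. Proof. by []. Qed.

Lemma bopZ_fun (c : R[i]) T x : (c *: T) x = c *: T x. Proof. by []. Qed.

Lemma bop_linear T : linear T. Proof. by have [] := bopP T. Qed.

Lemma bop0 T : T 0 = 0.
Proof.
by have := bop_linear T (-1) 0 0; rewrite scaler0 addr0 scaleN1r addNr.
Qed.

Lemma bopD T x y : T (x + y) = T x + T y.
Proof. by have := bop_linear T 1 x y; rewrite !scale1r. Qed.

Lemma bopZ T c x : T (c *: x) = c *: T x.
Proof. by have := bop_linear T c x 0; rewrite !addr0 bop0 addr0. Qed.

Lemma opnorm_has_sup T : has_sup [set nrm (T x) | x in [set x | nrm x <= 1]].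
Proof.
have [_ [M bT]] := bopP T; split.
  by exists (nrm (T 0)), 0 => //=; rewrite nrm0.
exists (Num.max M 0) => _ [x /= x1 <-]; apply: (le_trans (bT x)).
apply: (@le_trans _ _ (Num.max M 0 * nrm x)).
  by rewrite ler_wpM2r ?nrm_ge0// le_max lexx.
by rewrite ler_piMr// le_max lexx orbT.
Qed.

Lemma opnorm_ge0 T : 0 <= opnorm T.
Proof.
apply: (@le_trans _ _ (nrm (T 0))); first exact: nrm_ge0.
by apply: ub_le_sup; [have [] := opnorm_has_sup T | exists 0 => //=; rewrite nrm0].
Qed.

Lemma le_opnorm T x : nrm (T x) <= opnorm T * nrm x.
Proof.
have [x0|x0] := eqVneq (nrm x) 0.
  by rewrite (nrm0_eq0 x0) bop0 nrm0 mulr0.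
have xp : 0 < nrm x by rewrite lt_def x0 nrm_ge0.
have xi : normc (nrm x)^-1%:C = (nrm x)^-1.
  by rewrite /= expr0n/= addr0 sqrtr_sqr ger0_norm// invr_ge0 nrm_ge0.
rewrite -ler_pdivrMr// mulrC -{1}xi -nrmZ -bopZ.
apply: ub_le_sup; first by have [] := opnorm_has_sup T.
by exists ((nrm x)^-1%:C *: x) => //=; rewrite nrmZ xi mulVf.
Qed.

Lemma opnorm_le T (M : R) : 0 <= M ->
  (forall x, nrm (T x) <= M * nrm x) -> opnorm T <= M.
Proof.
move=> M0 bT; apply: ge_sup; first by have [] := opnorm_has_sup T.
move=> _ [x /= x1 <-]; apply: (le_trans (bT x)).
by rewrite ler_piMr.
Qed.

Lemma opnormD S T : opnorm (S + T) <= opnorm S + opnorm T.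
Proof.
apply: opnorm_le => [|x]; first by rewrite addr_ge0 ?opnorm_ge0.
rewrite bopD_fun mulrDl; apply: (le_trans (ler_nrmD _ _)).
by rewrite lerD ?le_opnorm.
Qed.

Lemma opnormZ (c : R[i]) T : opnorm (c *: T) = normc c * opnorm T.
Proof.
have le1 (d : R[i]) S : opnorm (d *: S) <= normc d * opnorm S.
  apply: opnorm_le => [|x]; first by rewrite mulr_ge0 ?opnorm_ge0// normc_ge0.
  by rewrite bopZ_fun nrmZ -mulrA ler_wpM2l ?le_opnorm// normc_ge0.
apply/le_anti/andP; split; first exact: le1.
have [->|c0] := eqVneq c 0; first by rewrite normc0 mul0r opnorm_ge0.
have cp : 0 < normc c.
  by rewrite lt_def normc_ge0 andbT; apply: contra c0 => /eqP/eq0_normc ->.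
have := le1 c^-1 (c *: T); rewrite scalerA mulVf// scale1r normcV.
by rewrite mulrC ler_pdivlMr// mulrC.
Qed.

Lemma opnorm_eq0 T : opnorm T = 0 -> T = 0.
Proof.
move=> T0; apply/val_inj/funext => x; apply: nrm0_eq0; apply/le_anti.
by rewrite nrm_ge0 andbT (le_trans (le_opnorm T x))// T0 mul0r.
Qed.

Let norm T : R[i] := (opnorm T)%:C.

Let normD S T : norm (S + T) <= norm S + norm T.
Proof. by rewrite -rmorphD lecR opnormD. Qed.

Let normZ (c : R[i]) T : norm (c *: T) = `|c| * norm T.
Proof. by rewrite /norm opnormZ rmorphM. Qed.

Let norm_eq0 T : norm T = 0 -> T = 0.
Proof. by move=> /complexI/opnorm_eq0. Qed.

HB.instance Definition _ :=
  Lmodule_isNormed.Build R[i] (bop E) normD normZ norm_eq0.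

Lemma nrm_bop T : nrm T = opnorm T. Proof. by []. Qed.

Lemma bop_comp_subproof S T : S \o T \in @bounded_linear_pred E.
Proof.
rewrite inE; split; first by move=> k x y /=; rewrite !bop_linear.
exists (opnorm S * opnorm T) => x /=; apply: (le_trans (le_opnorm S (T x))).
by rewrite -mulrA ler_wpM2l ?opnorm_ge0// le_opnorm.
Qed.

Definition bop_comp S T : bop E := Bop (bop_comp_subproof S T).

Let compA : associative bop_comp.
Proof. by move=> ? ? ?; apply/val_inj. Qed.

Let compDl : left_distributive bop_comp +%R.
Proof. by move=> ? ? ?; apply/val_inj. Qed.

Let compDr : right_distributive bop_comp +%R.
Proof. by move=> ? ? ?; apply/val_inj/funext => x /=; rewrite bopD. Qed.

Let compZl (k : R[i]) S T : bop_comp (k *: S) T = k *: bop_comp S T.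
Proof. by apply/val_inj. Qed.

Let compZr (k : R[i]) S T : bop_comp S (k *: T) = k *: bop_comp S T.
Proof. by apply/val_inj/funext => x /=; rewrite bopZ. Qed.

Let ler_norm_comp S T : `|bop_comp S T| <= `|S| * `|T|.
Proof.
rewrite !nrmE -rmorphM lecR !nrm_bop; apply: opnorm_le => [|x].
  by rewrite mulr_ge0 ?opnorm_ge0.
apply: (le_trans (le_opnorm S (T x))).
by rewrite -mulrA ler_wpM2l ?opnorm_ge0// le_opnorm.
Qed.

HB.instance Definition _ := NormedModule_isNormedAlgebra.Build R[i] (bop E)
  compA compDl compDr compZl compZr ler_norm_comp.

End bop_structure.
End bounded_operators.

Section seminorm.
Context {R : realType} {V : lmodType R[i]}.

Record is_seminorm (N : V -> R) : Prop := IsSeminorm {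
  seminormD : forall x y, N (x + y) <= N x + N y;
  seminormZ : forall (c : R[i]) x, N (c *: x) = normc c * N x }.

Variables (N : V -> R) (HN : is_seminorm N).

Lemma seminorm0 : N 0 = 0.
Proof. by rewrite -[0](scale0r 0) (seminormZ HN) normc0 mul0r. Qed.

Lemma seminormN x : N (- x) = N x.
Proof. by rewrite -scaleN1r (seminormZ HN) normcN normc1 mul1r. Qed.

Lemma seminorm_ge0 x : 0 <= N x.
Proof.
have := seminormD HN x (- x); rewrite subrr seminorm0 seminormN.
by rewrite -mulr2n pmulrn_lge0.
Qed.

Lemma seminorm_dist x y : `|N x - N y| <= N (x - y).
Proof.
have h u v : N u - N v <= N (u - v).
  by rewrite lerBlDr; have := seminormD HN (u - v) v; rewrite subrK.
by rewrite ler_norml (h x y) andbT lerNl -(seminormN (x - y)) !opprB h.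
Qed.

Definition null_pred of is_seminorm N : {pred V} := [pred x | N x == 0].

Lemma null_zmod_closed : zmod_closed (null_pred HN).
Proof.
split; rewrite ?inE ?seminorm0// => x y; rewrite !inE => /eqP x0 /eqP y0.
apply/eqP/le_anti; rewrite seminorm_ge0 andbT.
by apply: (le_trans (seminormD HN _ _)); rewrite seminormN x0 y0 addr0.
Qed.

HB.instance Definition _ :=
  GRing.isZmodClosed.Build V (null_pred HN) null_zmod_closed.

(* V modulo the subspace where the seminorm N vanishes, normed by N *)
Definition sepquot := Quotient.quot (null_pred HN).

HB.instance Definition _ := GRing.Zmodule.on sepquot.
HB.instance Definition _ := EqQuotient.on sepquot.

Definition sep_pi (x : V) : sepquot := \pi_sepquot x.

Lemma sep_piE x y : sep_pi x = sep_pi y <-> N (x - y) = 0.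
Proof.
have h := Quotient.idealrBE (null_pred HN) x y; split.
  by move=> xy; apply/eqP; move: h; rewrite inE => ->; apply/eqP.
by move=> /eqP xy; apply/eqP; move: h; rewrite inE xy => <-.
Qed.

Lemma sep_piK (q : sepquot) : sep_pi (repr q) = q.
Proof. exact: reprK. Qed.

Lemma sep_reprK x : N (repr (sep_pi x) - x) = 0.
Proof. by apply/sep_piE; exact: sep_piK. Qed.

Lemma sep_piD x y : sep_pi (x + y) = sep_pi x + sep_pi y.
Proof. by rewrite /sep_pi !piE. Qed.

Lemma seminorm_eq x y : N (x - y) = 0 -> N x = N y.
Proof.
by move=> xy; have := seminorm_dist x y; rewrite xy normr_le0 subr_eq0 => /eqP.
Qed.

Definition sep_scale (c : R[i]) (q : sepquot) : sepquot := sep_pi (c *: repr q).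

Lemma sep_scale_pi c x : sep_scale c (sep_pi x) = sep_pi (c *: x).
Proof.
apply/sep_piE; rewrite -scalerBr (seminormZ HN).
by rewrite sep_reprK mulr0.
Qed.

Let scaleA (a b : R[i]) q : sep_scale a (sep_scale b q) = sep_scale (a * b) q.
Proof. by rewrite -(sep_piK q) !sep_scale_pi scalerA. Qed.

Let scale1 : left_id 1 sep_scale.
Proof. by move=> q; rewrite -(sep_piK q) !sep_scale_pi scale1r. Qed.

Let scaleDr : right_distributive sep_scale +%R.
Proof.
move=> a p q; rewrite -(sep_piK p) -(sep_piK q) -sep_piD !sep_scale_pi.
by rewrite -sep_piD scalerDr.
Qed.

Let scaleDl q : {morph sep_scale^~ q : a b / a + b}.
Proof.
by move=> a b; rewrite -(sep_piK q) !sep_scale_pi -sep_piD scalerDl.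
Qed.

HB.instance Definition _ := GRing.Zmodule_isLmodule.Build R[i] sepquot
  scaleA scale1 scaleDr scaleDl.

Lemma sep_piZ c x : sep_pi (c *: x) = c *: sep_pi x.
Proof. exact/esym/sep_scale_pi. Qed.

Definition sep_norm (q : sepquot) : R[i] := (N (repr q))%:C.

Lemma sep_norm_pi x : sep_norm (sep_pi x) = (N x)%:C.
Proof. by rewrite /sep_norm (seminorm_eq (sep_reprK x)). Qed.

Let normD p q : sep_norm (p + q) <= sep_norm p + sep_norm q.
Proof.
rewrite -(sep_piK p) -(sep_piK q) -sep_piD !sep_norm_pi -rmorphD lecR.
exact: seminormD HN _ _.
Qed.

Let normZ (c : R[i]) q : sep_norm (c *: q) = `|c| * sep_norm q.
Proof.
by rewrite -(sep_piK q) -sep_piZ !sep_norm_pi (seminormZ HN) rmorphM.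
Qed.

Let norm_eq0 q : sep_norm q = 0 -> q = 0.
Proof.
rewrite -(sep_piK q) sep_norm_pi => /complexI q0.
have -> : 0 = sep_pi 0 by rewrite /sep_pi !piE.
by apply/sep_piE; rewrite subr0.
Qed.

HB.instance Definition _ :=
  Lmodule_isNormed.Build R[i] sepquot normD normZ norm_eq0.

Lemma nrm_sep_pi x : nrm (sep_pi x) = N x.
Proof. by apply: complexI; rewrite -nrmE; exact: sep_norm_pi. Qed.

End seminorm.

Section completion.
Context {R : realType} {V : lmodType R[i]}.

Definition cauchy_pred (N : V -> R) : {pred nat -> V} :=
  mem [set u : nat -> V | forall e : R, 0 < e -> exists n0 : nat,
    forall m n, (n0 <= m)%N -> (n0 <= n)%N -> N (u m - u n) < e].

Record cauchy_seq (N : V -> R) (HN : is_seminorm N) :=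
  CauchySeq { cauchy_fun :> nat -> V; _ : cauchy_fun \in cauchy_pred N }.

Variables (N : V -> R) (HN : is_seminorm N).

HB.instance Definition _ := [isSub for @cauchy_fun N HN].
HB.instance Definition _ := [Choice of cauchy_seq HN by <:].

Lemma cauchy_seqP (u : cauchy_seq HN) (e : R) : 0 < e -> exists n0 : nat,
  forall m n, (n0 <= m)%N -> (n0 <= n)%N -> N (u m - u n) < e.
Proof. by have := valP u; rewrite inE => /(_ e). Qed.

Lemma cauchy_submod : submod_closed (cauchy_pred N).
Proof.
split.
  rewrite inE => e e0; exists 0%N => m n _ _.
  by rewrite subrr (seminorm0 HN).
move=> c u v /[!inE] cu cv e e0.
have k0 : 0 < normc c + 1 by rewrite ltr_wpDl ?normc_ge0.
have e2 : 0 < e / 2 by rewrite divr_gt0.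
have [m1 h1] := cu (e / 2 / (normc c + 1)) (divr_gt0 e2 k0).
have [m2 h2] := cv (e / 2) e2.
exists (maxn m1 m2) => m n; rewrite !geq_max => /andP[m1m m2m] /andP[m1n m2n].
rewrite !fctE opprD addrACA -scalerBr (splitr e).
apply: (le_lt_trans (seminormD HN _ _)); apply: ler_ltD; last exact: h2.
rewrite (seminormZ HN).
apply: (@le_trans _ _ ((normc c + 1) * N (u m - u n))).
  by rewrite ler_wpM2r ?(seminorm_ge0 HN)// lerDl.
by rewrite mulrC -ler_pdivlMr//; apply/ltW/h1.
Qed.

HB.instance Definition _ :=
  GRing.isSubmodClosed.Build _ _ (cauchy_pred N) cauchy_submod.
HB.instance Definition _ := [SubChoice_isSubLmodule of cauchy_seq HN by <:].

Definition cauchy_norm (u : cauchy_seq HN) : R := limn (fun n => N (u n)).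

Lemma cvg_cauchy_norm (u : cauchy_seq HN) :
  N (u n) @[n --> \oo] --> cauchy_norm u.
Proof.
apply/cauchy_cvgP/cauchy_ballP => e e0.
have [n0 h] := cauchy_seqP u e0.
exists ([set x | exists2 n, (n0 <= n)%N & x = N (u n)], 
        [set x | exists2 n, (n0 <= n)%N & x = N (u n)]).
  by split; exists n0 => // n /= n0n; exists n.
move=> [_ _] [] /= [m n0m ->] [n n0n ->].
rewrite /ball/= /ball_/=.
by apply: le_lt_trans (h m n n0m n0n); exact: seminorm_dist.
Qed.

Lemma cauchy_seminorm : is_seminorm cauchy_norm.
Proof.
split=> [u v|c u].
  have h := cvgB (cvgD (@cvg_cauchy_norm u) (@cvg_cauchy_norm v))
    (@cvg_cauchy_norm (u + v)).
  rewrite -subr_ge0; apply: (cvgr_to_ge (h _ _)).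
  by apply: nearW => n; rewrite subr_ge0; exact: (seminormD HN).
apply: (cvg_unique _ (@cvg_cauchy_norm (c *: u))) => //.
rewrite (_ : (fun n => _) = fun n => normc c * N (u n)).
  by apply: cvgM; [exact: cvg_cst|exact: cvg_cauchy_norm].
by apply/funext => n; exact: (seminormZ HN).
Qed.

(* Hausdorff completion: Cauchy sequences modulo the sequences u such that
   N (u n) tends to 0, normed by the limit of N (u n) *)
Definition completion := sepquot cauchy_seminorm.

HB.instance Definition _ := NormedModule.on completion.

Lemma cst_cauchy (x : V) : (fun=> x) \in cauchy_pred N.
Proof. by rewrite inE => e e0; exists 0%N => *; rewrite subrr (seminorm0 HN). Qed.

Definition to_completion (x : V) : completion :=
  sep_pi cauchy_seminorm (CauchySeq HN (cst_cauchy x)).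

End completion.

Section algebra_completion.
Context {R : realType} {V : lmodType R[i]}.

Record is_algebra_seminorm (mul : V -> V -> V) (N : V -> R) : Prop :=
  IsAlgebraSeminorm {
    alg_seminorm : is_seminorm N;
    alg_mulA : associative mul;
    alg_mulDl : left_distributive mul +%R;
    alg_mulDr : right_distributive mul +%R;
    alg_mulZl : forall (k : R[i]) x y, mul (k *: x) y = k *: mul x y;
    alg_mulZr : forall (k : R[i]) x y, mul x (k *: y) = k *: mul x y;
    alg_ler_mul : forall x y, N (mul x y) <= N x * N y }.

Variables (mul : V -> V -> V) (N : V -> R) (H : is_algebra_seminorm mul N).
Let HN := alg_seminorm H.

Let mulB x y x' y' : mul x y - mul x' y' = mul (x - x') y + mul x' (y - y').
Proof.
have mulBl a b c : mul (a - b) c = mul a c - mul b c.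
  by rewrite (alg_mulDl H) -[- b]scaleN1r (alg_mulZl H) scaleN1r.
have mulBr a b c : mul a (b - c) = mul a b - mul a c.
  by rewrite (alg_mulDr H) -[- c]scaleN1r (alg_mulZr H) scaleN1r.
by rewrite mulBl mulBr addrA subrK.
Qed.

Let ler_mulB x y x' y' :
  N (mul x y - mul x' y') <= N (x - x') * N y + N x' * N (y - y').
Proof.
rewrite mulB; apply: (le_trans (seminormD HN _ _)).
by apply: lerD; exact: (alg_ler_mul H).
Qed.

Lemma cauchy_bounded (u : cauchy_seq HN) : exists M : R, 0 < M /\
  exists n0 : nat, forall n, (n0 <= n)%N -> N (u n) <= M.
Proof.
have [n0 h] := cauchy_seqP u ltr01; exists (N (u n0) + 1); split.
  by rewrite ltr_wpDl ?(seminorm_ge0 HN).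
exists n0 => n n0n; rewrite -lerBlDl; apply/ltW.
apply: le_lt_trans (h n n0 n0n (leqnn _)).
exact: (le_trans (ler_norm _) (seminorm_dist HN _ _)).
Qed.

Lemma cauchy_mul_subproof (u v : cauchy_seq HN) :
  (fun n => mul (u n) (v n)) \in cauchy_pred N.
Proof.
rewrite inE => e e0.
have e2 : 0 < e / 2 by rewrite divr_gt0.
have [M [M0 [n1 hM]]] := cauchy_bounded u.
have [K [K0 [n2 hK]]] := cauchy_bounded v.
have [n3 hu] := cauchy_seqP u (divr_gt0 e2 K0).
have [n4 hv] := cauchy_seqP v (divr_gt0 e2 M0).
exists (maxn (maxn n1 n2) (maxn n3 n4)) => m n; rewrite !geq_max.
move=> /andP[/andP[m1 m2] /andP[m3 m4]] /andP[/andP[k1 k2] /andP[k3 k4]].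
apply: (le_lt_trans (ler_mulB _ _ _ _)); rewrite (splitr e) ltr_leD//.
  apply: (@le_lt_trans _ _ (N (u m - u n) * K)).
    by rewrite ler_wpM2l ?(seminorm_ge0 HN) ?hK.
  by rewrite -ltr_pdivlMr// hu.
apply: (@le_trans _ _ (M * N (v m - v n))).
  by rewrite ler_wpM2r ?(seminorm_ge0 HN) ?hM.
by rewrite mulrC -ler_pdivlMr// ltW// hv.
Qed.

Definition cauchy_mul (u v : cauchy_seq HN) : cauchy_seq HN :=
  CauchySeq HN (cauchy_mul_subproof u v).

Definition alg_completion := completion HN.

HB.instance Definition _ := NormedModule.on alg_completion.

Let pi (u : cauchy_seq HN) : alg_completion := sep_pi (cauchy_seminorm HN) u.

Let piK (x : alg_completion) : pi (repr x) = x.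
Proof. exact: sep_piK. Qed.

Definition completion_mul (x y : alg_completion) : alg_completion :=
  pi (cauchy_mul (repr x) (repr y)).

Lemma completion_mul_pi (u v : cauchy_seq HN) :
  completion_mul (pi u) (pi v) = pi (cauchy_mul u v).
Proof.
apply/sep_piE; rewrite -/(pi u) -/(pi v).
set u' := repr (pi u); set v' := repr (pi v).
have u0 := sep_reprK (cauchy_seminorm HN) u.
have v0 := sep_reprK (cauchy_seminorm HN) v.
rewrite -/(pi u) -/(pi v) -/u' -/v' in u0 v0.
have hu := @cvg_cauchy_norm _ _ _ HN (u' - u).
have hv := @cvg_cauchy_norm _ _ _ HN (v' - v).
have cu := @cvg_cauchy_norm _ _ _ HN u.
have cv := @cvg_cauchy_norm _ _ _ HN v'.
have h := cvgD (cvgM hu cv) (cvgM cu hv).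
rewrite u0 v0 mul0r mulr0 addr0 in h.
have h' := @cvg_cauchy_norm _ _ _ HN (cauchy_mul u' v' - cauchy_mul u v).
have k := cvgB (h _ _ _) h'.
apply/le_anti; rewrite (seminorm_ge0 (cauchy_seminorm HN)) andbT.
rewrite -subr_ge0; apply: (cvgr_to_ge (k _ _ _ _)).
by apply: nearW => n; rewrite subr_ge0; exact: ler_mulB.
Qed.

Let piD u v : pi (u + v) = pi u + pi v. Proof. exact: sep_piD. Qed.

Let piZ c u : pi (c *: u) = c *: pi u. Proof. exact: sep_piZ. Qed.

Let cmulA : associative completion_mul.
Proof.
move=> x y z; rewrite -(piK x) -(piK y) -(piK z) !completion_mul_pi.
by congr pi; apply/val_inj/funext => n; exact: (alg_mulA H).
Qed.

Let cmulDl : left_distributive completion_mul +%R.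
Proof.
move=> x y z; rewrite -(piK x) -(piK y) -(piK z) -piD !completion_mul_pi -piD.
by congr pi; apply/val_inj/funext => n; exact: (alg_mulDl H).
Qed.

Let cmulDr : right_distributive completion_mul +%R.
Proof.
move=> x y z; rewrite -(piK x) -(piK y) -(piK z) -piD !completion_mul_pi -piD.
by congr pi; apply/val_inj/funext => n; exact: (alg_mulDr H).
Qed.

Let cmulZl (k : R[i]) x y : completion_mul (k *: x) y = k *: completion_mul x y.
Proof.
rewrite -(piK x) -(piK y) -piZ !completion_mul_pi -piZ.
by congr pi; apply/val_inj/funext => n; exact: (alg_mulZl H).
Qed.

Let cmulZr (k : R[i]) x y : completion_mul x (k *: y) = k *: completion_mul x y.
Proof.
rewrite -(piK x) -(piK y) -piZ !completion_mul_pi -piZ.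
by congr pi; apply/val_inj/funext => n; exact: (alg_mulZr H).
Qed.

Let nrm_pi u : nrm (pi u) = cauchy_norm u. Proof. exact: nrm_sep_pi. Qed.

Let ler_cmul x y : `|completion_mul x y| <= `|x| * `|y|.
Proof.
rewrite -(piK x) -(piK y) completion_mul_pi !nrmE -rmorphM lecR !nrm_pi.
have h := cvgM (@cvg_cauchy_norm _ _ _ HN (repr x))
  (@cvg_cauchy_norm _ _ _ HN (repr y)).
have k := cvgB (h _) (@cvg_cauchy_norm _ _ _ HN
  (cauchy_mul (repr x) (repr y))).
rewrite -subr_ge0; apply: (cvgr_to_ge (k _ _)).
by apply: nearW => n; rewrite subr_ge0; exact: (alg_ler_mul H).
Qed.

HB.instance Definition _ :=
  NormedModule_isNormedAlgebra.Build R[i] alg_completion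
    cmulA cmulDl cmulDr cmulZl cmulZr ler_cmul.

End algebra_completion.

Section completion_complete.
Context {R : realType} {V : lmodType R[i]}.
Variables (N : V -> R) (HN : is_seminorm N).
Local Notation to := (to_completion HN).

Lemma nrm_completionB (u : cauchy_seq HN) (x : V) (e : R) (n0 : nat) :
  (forall n, (n0 <= n)%N -> N (u n - x) <= e) ->
  nrm (sep_pi (cauchy_seminorm HN) u - to x) <= e.
Proof.
move=> h.
have -> : sep_pi (cauchy_seminorm HN) u - to x =
    sep_pi (cauchy_seminorm HN) (u - CauchySeq HN (cst_cauchy HN x)).
  by rewrite sep_piD; congr (_ + _); rewrite -scaleN1r -sep_piZ scaleN1r.
rewrite nrm_sep_pi.
have := @cvg_cauchy_norm _ _ _ HN (u - CauchySeq HN (cst_cauchy HN x)).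
by move=> /cvgr_to_le; apply; exists n0.
Qed.

Lemma nrm_to_completionB (x y : V) : nrm (to x - to y) = N (x - y).
Proof.
have -> : to x - to y = sep_pi (cauchy_seminorm HN)
    (CauchySeq HN (cst_cauchy HN x) - CauchySeq HN (cst_cauchy HN y)).
  by rewrite sep_piD; congr (_ + _); rewrite -scaleN1r -sep_piZ scaleN1r.
rewrite nrm_sep_pi; apply: (cvg_unique _ (@cvg_cauchy_norm _ _ _ HN _)) => //.
exact: (@cvg_cst _ (N (x - y))).
Qed.

Lemma to_completion_dense (q : completion HN) (e : R) : 0 < e ->
  exists x, nrm (q - to x) < e.
Proof.
move=> e0; have e2 : 0 < e / 2 by rewrite divr_gt0.
have [n0 h] := cauchy_seqP (repr q : cauchy_seq HN) e2.
exists ((repr q : cauchy_seq HN) n0).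
rewrite -{1}(sep_piK q).
apply: (@le_lt_trans _ _ (e / 2)).
  by apply: (@nrm_completionB _ _ _ n0) => n n0n; apply/ltW/h.
by rewrite ltr_pdivrMr// ltr_pMr// ltr1n.
Qed.

Lemma completion_ballE (q r : completion HN) (e : R) :
  ball q e%:C r <-> nrm (q - r) < e.
Proof. by rewrite -ball_normE /ball_/= nrmE ltcR. Qed.

Lemma completion_complete (F : set_system (completion HN)) :
  ProperFilter F -> cauchy F -> cvg F.
Proof.
move=> FF /(cauchyP F) Fc.
pose r (n : nat) : R := n.+1%:R^-1.
have r0 n : 0 < r n by rewrite invr_gt0.
have /choice[x hx] n : exists x, F (ball (to x) (r n + r n)%:C).
  have [|q Fq] := Fc (r n)%:C; first by rewrite ltcR.
  have [x xq] := to_completion_dense q (r0 n); exists x.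
  apply: filterS Fq => y /completion_ballE qy; apply/completion_ballE.
  rewrite -(subrK q (to x)) -addrA; apply: (le_lt_trans (ler_nrmD _ _)).
  by rewrite ltrD// -nrmN opprB.
have xN m n : N (x m - x n) < (r m + r m) + (r n + r n).
  have [y [/completion_ballE ym /completion_ballE yn]] :=
    filter_ex (filterI (hx m) (hx n)).
  rewrite -nrm_to_completionB -(subrK y (to (x m))) -addrA.
  apply: (le_lt_trans (ler_nrmD _ _)).
  by rewrite ltrD// -nrmN opprB.
have rle m n : (m <= n)%N -> r n <= r m.
  by move=> mn; rewrite lef_pV2 ?posrE// ler_nat ltnS.
have rlt (e : R) : 0 < e -> exists n, r n < e.
  move=> e0; have [n _ h] := near_infty_natSinv_lt (PosNum e0).
  by exists n; apply: h => /=.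
have cx : x \in cauchy_pred N.
  rewrite inE => e e0; have e4 : 0 < e / 2 / 2 by rewrite !divr_gt0.
  have [n0 h0] := rlt (e / 2 / 2) e4.
  exists n0 => m n /rle m0 /rle k0; apply: (lt_le_trans (xN m n)).
  have h m' : r m' <= r n0 -> r m' <= e / 2 / 2 by move=> /le_trans; apply; exact: ltW.
  rewrite (splitr e) (splitr (e / 2)).
  by rewrite !lerD ?h.
pose q : completion HN := sep_pi (cauchy_seminorm HN) (CauchySeq HN cx).
apply/cvg_ex; exists q; apply/fcvgrPdist_lt => /= e.
rewrite ltcE/= => /andP[/eqP eim e0].
have e8 : 0 < complex.Re e / 2 / 2 / 2 by rewrite !divr_gt0.
have [n0 h0] := rlt (complex.Re e / 2 / 2 / 2) e8.
apply: filterS (hx n0) => y /completion_ballE xy.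
have qx : nrm (q - to (x n0)) <= (r n0 + r n0) + (r n0 + r n0).
  apply: (@nrm_completionB _ _ _ n0) => n n0n; apply/ltW.
  apply: (lt_le_trans (xN n n0)); rewrite lerD2r.
  by rewrite lerD ?rle.
rewrite nrmE ltcE/= eim eqxx/= -(subrK (to (x n0)) q) -addrA.
apply: (le_lt_trans (ler_nrmD _ _)).
apply: (lt_trans (ler_ltD qx xy)).
set E := complex.Re e in e0 e8 h0 *.
have rr2 : r n0 + r n0 < E / 2 / 2 by rewrite (splitr (E / 2 / 2)) ltrD.
have rr4 : (r n0 + r n0) + (r n0 + r n0) < E / 2.
  by rewrite (splitr (E / 2)) ltrD.
rewrite (splitr E) ltrD//; apply: (lt_trans rr2).
by rewrite [ltRHS]splitr ltrDl !divr_gt0.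
Qed.

HB.instance Definition _ :=
  Uniform_isComplete.Build (completion HN) completion_complete.

End completion_complete.

HB.instance Definition _ (R : realType) (V : lmodType R[i])
    (mul : V -> V -> V) (N : V -> R) (H : is_algebra_seminorm mul N) :=
  Complete.on (alg_completion H).


Section complex_Lp.
Context {R : realType} {d : measure_display} {X : measurableType d}.
Variable mu : {measure set X -> \bar R}.
Variable p : R.

Definition Lp_seminorm (f : X -> R[i]) : \bar R :=
  'N[mu]_p%:E[EFin \o (@normc R \o f)]%E.

Definition Lp_pred : {pred X -> R[i]} :=
  mem [set f : X -> R[i] | [/\ measurable_fun setT (@complex.Re R \o f),
    measurable_fun setT (@complex.Im R \o f) & (Lp_seminorm f < +oo)%E]].

Record Lp_fun (p1 : 1 <= p) := LpFun {
  Lp_fun_fun :> X -> R[i]; Lp_fun_subproof : Lp_fun_fun \in Lp_pred }.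

Variable p1 : 1 <= p.

HB.instance Definition _ := [isSub for @Lp_fun_fun p1].
HB.instance Definition _ := [Choice of Lp_fun p1 by <:].

Lemma measurable_normc (f : X -> R[i]) : measurable_fun setT (@complex.Re R \o f) ->
  measurable_fun setT (@complex.Im R \o f) -> measurable_fun setT (@normc R \o f).
Proof.
move=> mr mi.
rewrite (_ : _ \o _ = Num.sqrt \o
    (fun x => (@complex.Re R \o f) x ^+ 2 + (@complex.Im R \o f) x ^+ 2)); last first.
  by apply/funext => x /=; case: (f x).
apply: measurableT_comp.
  by apply: continuous_measurable_fun => x; exact: sqrt_continuous.
by apply: measurable_funD; exact: measurable_funX.
Qed.

Lemma Lnorm_mono (f g : X -> R) :
  measurable_fun setT f -> measurable_fun setT g ->
  (forall x, 0 <= f x <= g x) ->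
  ('N[mu]_p%:E[EFin \o f] <= 'N[mu]_p%:E[EFin \o g])%E.
Proof.
move=> mf mg fg; have p0 : 0 <= p by rewrite (le_trans _ p1).
have f0 x : 0 <= f x by have /andP[] := fg x.
have g0 x : 0 <= g x by have /andP[h1 h2] := fg x; exact: le_trans h2.
rewrite unlock; apply: gt0_ler_poweR; first by rewrite invr_ge0.
- by rewrite in_itv/= leey andbT integral_ge0// => x _; exact: poweR_ge0.
- by rewrite in_itv/= leey andbT integral_ge0// => x _; exact: poweR_ge0.
apply: ge0_le_integral => //.
- by move=> x _; exact: poweR_ge0.
- apply: (measurableT_comp (measurable_poweR _)).
  apply: measurableT_comp => //; exact/measurable_EFinP.
- apply: (measurableT_comp (measurable_poweR _)).
  apply: measurableT_comp => //; exact/measurable_EFinP.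
move=> x _ /=; rewrite !ger0_norm// lee_fin.
by rewrite ge0_ler_powR ?nnegrE//; have /andP[] := fg x.
Qed.

Lemma Lnorm_scale (k : R) (f : X -> R) : 0 <= k -> f \in Lfun mu p%:E ->
  'N[mu]_p%:E[EFin \o (fun x => k * f x)%R]%E = (k%:E * 'N[mu]_p%:E[EFin \o f])%E.
Proof.
move=> k0 fL; have p1' : (1%:E <= p%:E)%E by rewrite lee_fin.
by have := LnormZ (Lfun_Sub p1' fL) k; rewrite ger0_norm.
Qed.

Lemma Lp_normc_Lfun (f : X -> R[i]) : f \in Lp_pred ->
  (@normc R \o f : X -> R) \in Lfun mu p%:E.
Proof.
rewrite inE => -[mr mi fo]; rewrite inE/=; apply/andP; split; rewrite inE//=.
exact: measurable_normc.
Qed.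

Let Re_comb (c a b : R[i]) : complex.Re (c * a + b) =
  complex.Re c * complex.Re a - complex.Im c * complex.Im a + complex.Re b.
Proof. by case: c a b => [? ?] [? ?] []. Qed.

Let Im_comb (c a b : R[i]) : complex.Im (c * a + b) =
  complex.Re c * complex.Im a + complex.Im c * complex.Re a + complex.Im b.
Proof. by case: c a b => [? ?] [? ?] []. Qed.

Let measurable_comb (c : R[i]) (f g : X -> R[i]) :
  f \in Lp_pred -> g \in Lp_pred ->
  measurable_fun setT (@complex.Re R \o (c *: f + g)) /\
  measurable_fun setT (@complex.Im R \o (c *: f + g)).
Proof.
rewrite !inE => -[fr fi _] [gr gi _]; split.
  rewrite (_ : _ \o _ = fun x => complex.Re c * (@complex.Re R \o f) x -
      complex.Im c * (@complex.Im R \o f) x + (@complex.Re R \o g) x).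
    by apply: measurable_funD => //; apply: measurable_funB;
       exact: measurable_funM.
  by apply/funext => x; exact: Re_comb.
rewrite (_ : _ \o _ = fun x => complex.Re c * (@complex.Im R \o f) x +
    complex.Im c * (@complex.Re R \o f) x + (@complex.Im R \o g) x).
  by apply: measurable_funD => //; apply: measurable_funD;
     exact: measurable_funM.
by apply/funext => x; exact: Im_comb.
Qed.

Lemma Lp_seminorm_comb (c : R[i]) (f g : X -> R[i]) :
  f \in Lp_pred -> g \in Lp_pred ->
  (Lp_seminorm (c *: f + g)%R <= (normc c)%:E * Lp_seminorm f + Lp_seminorm g)%E.
Proof.
move=> fL gL; have := fL; have := gL.
rewrite !inE => -[gr gi go] [fr fi fo].
rewrite -Lnorm_scale ?normc_ge0 ?Lp_normc_Lfun//.
have mf := measurable_normc fr fi; have mg := measurable_normc gr gi.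
have mkf : measurable_fun setT (fun x => normc c * (@normc R \o f) x).
  by apply: measurable_funM.
apply: (le_trans _ (minkowski_EFin mu mkf mg p1)); apply: Lnorm_mono.
- by have [] := measurable_comb c fL gL; exact: measurable_normc.
- exact: measurable_funD.
move=> x; rewrite normc_ge0/= -normcM.
exact: le_normcD.
Qed.

Lemma Lp_seminormZ (c : R[i]) (f : X -> R[i]) : f \in Lp_pred ->
  Lp_seminorm (c *: f)%R = ((normc c)%:E * Lp_seminorm f)%E.
Proof.
move=> fL; rewrite -Lnorm_scale ?normc_ge0 ?Lp_normc_Lfun//.
by apply: eq_Lnorm => x /=; rewrite -normcM.
Qed.

Lemma Lp_seminorm_ge0 (f : X -> R[i]) : (0 <= Lp_seminorm f)%E.
Proof. exact: Lnorm_ge0. Qed.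

Lemma Lp_seminorm_fin (f : X -> R[i]) : f \in Lp_pred ->
  Lp_seminorm f = (fine (Lp_seminorm f))%:E.
Proof.
by rewrite inE => -[_ _ fo]; rewrite fineK// ge0_fin_numE ?Lp_seminorm_ge0.
Qed.

Lemma Lp_submod : submod_closed Lp_pred.
Proof.
have p0 : p != 0 by rewrite gt_eqF// (lt_le_trans ltr01).
have L0 : (0 : X -> R[i]) \in Lp_pred.
  rewrite inE; split; [exact: measurable_cst|exact: measurable_cst|].
  rewrite /Lp_seminorm (_ : _ \o _ = cst 0%E) ?Lnorm0//.
  by apply/funext => x /=; rewrite expr0n/= addr0 sqrtr0.
split=> // c f g fL gL; have [mr mi] := measurable_comb c fL gL.
rewrite inE; split=> //.
have := fL; have := gL; rewrite !inE => -[_ _ go] [_ _ fo].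
apply: (le_lt_trans (Lp_seminorm_comb c fL gL)).
by rewrite lte_add_pinfty// lte_mul_pinfty// lee_fin normc_ge0.
Qed.

HB.instance Definition _ := GRing.isSubmodClosed.Build _ _ Lp_pred Lp_submod.
HB.instance Definition _ := [SubChoice_isSubLmodule of Lp_fun p1 by <:].

Definition Lp_fun_norm (f : Lp_fun p1) : R := fine (Lp_seminorm f).

Lemma Lp_fun_seminorm : is_seminorm Lp_fun_norm.
Proof.
have fin (f : Lp_fun p1) : Lp_seminorm f = (Lp_fun_norm f)%:E.
  exact/Lp_seminorm_fin/Lp_fun_subproof.
split=> [f g|c f]; last first.
  by apply: EFin_inj; rewrite -fin Lp_seminormZ ?Lp_fun_subproof// fin.
rewrite -lee_fin EFinD -!fin.
have := Lp_seminorm_comb 1 (Lp_fun_subproof f) (Lp_fun_subproof g).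
by rewrite normc1 mul1e scale1r.
Qed.

Lemma Lp_fun_norm_eq0 (f : Lp_fun p1) :
  Lp_fun_norm f = 0 <-> {ae mu, forall x, f x = 0}.
Proof.
have := Lp_fun_subproof f; rewrite inE => -[fr fi fo].
have mf := measurable_normc fr fi.
have fE := Lp_seminorm_fin (Lp_fun_subproof f).
have p0 : 0 < p by rewrite (lt_le_trans ltr01).
split=> [f0|f0].
  rewrite -[fine _]/(Lp_fun_norm f) f0 in fE.
  have /measurable_EFinP mf' := mf.
  have := Lnorm_eq0_eq0 mf' _ fE; rewrite lte_fin => /(_ p0).
  by apply: filterS => x /= /(_ I) [] /eq0_normc.
suff : Lp_seminorm f = 0%E by rewrite /Lp_fun_norm => ->.
rewrite /Lp_seminorm unlock (_ : (\int[mu]_x _)%E = 0%E).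
  by rewrite poweR0r// invr_neq0// gt_eqF.
have -> : (0 = \int[mu]_(x in setT) (cst 0 x))%E by rewrite integral0.
apply: ae_eq_integral => //.
  apply: (measurableT_comp (measurable_poweR _)); apply: measurableT_comp => //.
  exact/measurable_EFinP.
apply: filterS f0 => x fx0 _ /=.
by rewrite fx0 /= expr0n/= addr0 sqrtr0 normr0 powR0// gt_eqF.
Qed.

(* functions modulo equality almost everywhere, by Lp_fun_norm_eq0 *)
Definition Lp := sepquot Lp_fun_seminorm.

HB.instance Definition _ := NormedModule.on Lp.

End complex_Lp.

Section bochner.
Context {R : realType} {d : measure_display} {T : measurableType d}.
Variables (nu : {measure set T -> \bar R}) (E : normedModType R[i]).

(* the list s stands for the simple function sum of 1_A e over (A, e) in s *)
Definition simple_fct (s : seq (set T * E)) (x : T) : E :=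
  \sum_(Ae <- s) (\1_Ae.1 x : R)%:C *: Ae.2.

Definition simple_int (s : seq (set T * E)) : E :=
  \sum_(Ae <- s) (fine (nu Ae.1))%:C *: Ae.2.

Definition simple_integrable (s : seq (set T * E)) :=
  forall Ae, Ae \in s -> measurable Ae.1 /\ (nu Ae.1 < +oo)%E.

(* convergence of simple functions is required everywhere, not only almost
   everywhere, so that the norms integrated below are measurable *)
Definition is_bochner_integral (f : T -> E) (I : E) :=
  exists s : nat -> seq (set T * E),
  [/\ forall n, simple_integrable (s n),
      forall x, simple_fct (s n) x @[n --> \oo] --> f x,
      (\int[nu]_x (nrm (f x - simple_fct (s n) x))%:E)%E @[n --> \oo] --> 0%E
    & simple_int (s n) @[n --> \oo] --> I].

(* total: 0 if f is not Bochner integrable *)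
Definition bochner_integral (f : T -> E) : E := xget 0 (is_bochner_integral f).

End bochner.

Notation borel G := (g_sigma_algebraType (@open G)).

Record left_haar {R : realType} {G : topologicalGroupType}
    (nu : {measure set (borel G) -> \bar R}) : Prop := LeftHaar {
  haar_neq0 : nu setT != 0%E;
  haar_left_invariant : forall (g : G) (A : set G), measurable (A : set (borel G)) ->
    nu [set (g * x)%g | x in A] = nu A;
  haar_compact : forall K : set G, compact K -> (nu K < +oo)%E;
  haar_outer_regular : forall A : set G, measurable (A : set (borel G)) ->
    nu A = ereal_inf [set nu U | U in [set U : set G | open U /\ A `<=` U]];
  haar_inner_regular : forall U : set G, open U ->
    nu U = ereal_sup [set nu K | K in [set K : set G | compact K /\ K `<=` U]] }.

Section Cc.
Context {R : realType} (G : topologicalType) (E : normedModType R[i]).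

Definition Cc_pred : {pred G -> E} :=
  mem [set f : G -> E | continuous f /\ compact (closure [set g | f g != 0])].

Record Cc := MkCc { Cc_fun :> G -> E; Cc_subproof : Cc_fun \in Cc_pred }.

HB.instance Definition _ := [isSub for Cc_fun].
HB.instance Definition _ := [Choice of Cc by <:].

Lemma Cc_submod : submod_closed Cc_pred.
Proof.
split.
  rewrite inE; split; first exact: cst_continuous.
  rewrite (_ : [set _ | _] = set0) ?closure0; first exact: compact0.
  by apply/seteqP; split=> // g /=; rewrite eqxx.
move=> c f h; rewrite !inE => -[fc fK] [hc hK]; split.
  by move=> x; apply: continuousD (hc x); apply: continuousZr; exact: fc.
apply: (subclosed_compact _ (compactU fK hK)); first exact: closed_closure.
rewrite -closureU; apply: closure_subset => g /= chn.
apply: contrapT => /not_orP[/negP/negbNE/eqP f0 /negP/negbNE/eqP h0].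
by move: chn; rewrite !fctE f0 h0 scaler0 addr0 eqxx.
Qed.

HB.instance Definition _ := GRing.isSubmodClosed.Build _ _ Cc_pred Cc_submod.
HB.instance Definition _ := [SubChoice_isSubLmodule of Cc by <:].

End Cc.
Arguments Cc_pred {R} G E.

Section representations.
Context {R : realType}.

Definition algebra_hom (A B : normedAlgType R[i]) (phi : A -> B) :=
  linear phi /\ forall a b, phi (nmul a b) = nmul (phi a) (phi b).

Definition contractive (A B : normedAlgType R[i]) (phi : A -> B) :=
  forall a, `|phi a| <= `|a|.

Definition isometric (A B : normedAlgType R[i]) (phi : A -> B) :=
  forall a, `|phi a| = `|a|.

Definition representation (A : normedAlgType R[i]) (E : normedModType R[i])
  (pi : A -> bop E) := algebra_hom pi /\ continuous pi.

Definition lin_span (E : normedModType R[i]) (S : set E) : set E :=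
  [set x | exists n (c : 'I_n -> R[i]) (s : 'I_n -> E),
    (forall i, S (s i)) /\ x = \sum_(i < n) c i *: s i].

Definition nondegenerate_rep (A : normedAlgType R[i]) (E : normedModType R[i])
    (pi : A -> bop E) :=
  dense (lin_span [set y | exists a x, y = pi a x]).

Variables (p : R) (p1 : 1 <= p).

Definition Lp_operator_algebra (A : banachAlgType R[i]) :=
  exists (d : measure_display) (X : measurableType d)
    (mu : {measure set X -> \bar R}) (phi : A -> bop (Lp mu p1)),
  [/\ algebra_hom phi, isometric phi & closed (range phi)].

Definition nondegenerately_sigma_finitely_representable
    (A : banachAlgType R[i]) :=
  exists (d : measure_display) (X : measurableType d)
    (mu : {measure set X -> \bar R}) (pi : A -> bop (Lp mu p1)),
  [/\ sigma_finite setT mu, representation pi, isometric pi & nondegenerate_rep pi].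

End representations.

(* bijectivity of alpha g follows from action1 and actionM *)
Record isometric_action {R : realType} {G : topologicalGroupType}
    {A : banachAlgType R[i]} (alpha : G -> A -> A) : Prop := IsometricAction {
  action_hom : forall g, algebra_hom (alpha g);
  action_isometric : forall g, isometric (alpha g);
  action1 : forall a, alpha 1%g a = a;
  actionM : forall g h a, alpha (g * h)%g a = alpha g (alpha h a);
  action_continuous : forall a, continuous (fun g => alpha g a) }.

Section crossed_product.
Context {R : realType} {G : topologicalGroupType}.
Variable nu : {measure set (borel G) -> \bar R}.
Context {A : banachAlgType R[i]}.
Variable alpha : G -> A -> A.

(* v (g^-1) is the inverse of v g, by cov_v1 and cov_vM *)
Record covariant_representation (E : normedModType R[i])
    (v : G -> bop E) (pi : A -> bop E) : Prop := CovariantRepresentation {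
  cov_v1 : forall x, v 1%g x = x;
  cov_vM : forall g h x, v (g * h)%g x = v g (v h x);
  cov_v_continuous : forall x, continuous (fun g => v g x);
  cov_pi : representation pi;
  cov_covariant : forall g a x, pi (alpha g a) x = v g (pi a (v g^-1%g x)) }.

Definition contractive_covariant (E : normedModType R[i])
    (v : G -> bop E) (pi : A -> bop E) :=
  [/\ covariant_representation v pi, forall g, `|v g| <= 1 & contractive pi].

Definition integrated_form (E : normedModType R[i])
    (v : G -> bop E) (pi : A -> bop E) (a : Cc G A) (x : E) : E :=
  bochner_integral nu (fun g : borel G => pi (a g) (v g x)).

Definition convolution (a b : Cc G A) (g : G) : A :=
  bochner_integral nu
    (fun h : borel G => nmul (a h) (alpha h (b (h^-1 * g)%g))).

Definition Cc_mul (convK : forall a b : Cc G A, convolution a b \in Cc_pred G A)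
    (a b : Cc G A) : Cc G A := MkCc (convK a b).

Variables (p : R) (p1 : 1 <= p).

Definition full_norms (a : Cc G A) : set R :=
  [set r | exists (d : measure_display) (X : measurableType d)
      (mu : {measure set X -> \bar R})
      (v : G -> bop (Lp mu p1)) (pi : A -> bop (Lp mu p1)),
    [/\ sigma_finite setT mu, contractive_covariant v pi, nondegenerate_rep pi
      & r = opnorm (integrated_form v pi a)] ].

Definition full_norm (a : Cc G A) : R := sup (full_norms a).

(* What has to hold for the Hausdorff completion of (Cc, convolution, full_norm)
   to make sense as a Banach algebra: Cc is stable under convolution, the
   supremum defining full_norm is one of a nonempty bounded set, and full_norm
   is a submultiplicative seminorm on an associative algebra. *)
Record crossed_product_wf : Prop := CrossedProductWf {
  convolution_Cc : forall a b : Cc G A, convolution a b \in Cc_pred G A;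
  full_norms_bounded : forall a, has_sup (full_norms a);
  full_norm_seminorm : is_algebra_seminorm (Cc_mul convolution_Cc) full_norm }.

Definition full_crossed_product (wf : crossed_product_wf) : banachAlgType R[i] :=
  alg_completion (full_norm_seminorm wf).

Definition extends_integrated_form (wf : crossed_product_wf)
    (iota : Cc G A -> full_crossed_product wf) (E : normedModType R[i])
    (v : G -> bop E) (pi : A -> bop E) (rho : full_crossed_product wf -> bop E) :=
  [/\ representation rho, contractive rho
    & forall a x, rho (iota a) x = integrated_form v pi a x].

End crossed_product.

(* Main.v *)
(** The seminorm of a function a of compact support K is at most
    sup |a| * nu(K), since |v_g| <= 1 and |pi(a(g))| <= |a(g)|; so the supremum
    over all representations is finite, and it is not over the empty set
    because L^p of the zero measure is the zero space.  It is submultiplicative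
    because every v |x pi is multiplicative, which like the associativity of the
    convolution comes from exchanging two integrals over G and a left
    translation.  All the integrands are continuous with compact support, so
    that exchange needs no measurability on G * G: F(x, y) is uniformly close to
    the sum of 1_(A_i)(x) F(x_i, y) over a fine finite partition (A_i) of the
    support.  The integrals defining v |x pi exist because L^p is complete
    (Riesz-Fischer).  The representation rho_(v, pi) is the continuous extension
    of v |x pi to the completion, and the norm formula passes from the dense
    image of C_c to the completion by contractivity. *)

Require Import Defs.
From mathcomp Require Import all_boot all_order all_algebra monoid finmap.
From mathcomp Require Import complex.
From mathcomp Require Import all_classical all_reals all_analysis.
From mathcomp Require Import measurable_realfun lra.

Set Implicit Arguments.
Unset Strict Implicit.
Unset Printing Implicit Defensive.

Import Order.TTheory GRing.Theory Num.Theory.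
Import numFieldNormedType.Exports.
Import Normc.

Local Open Scope classical_set_scope.
Local Open Scope ring_scope.
Local Open Scope complex_scope.

(** * Bochner integrals *)

(** [bochner_integral] takes a default value on functions that are not integrable, so identities
    between integrals are not proved on it directly: a witness of [is_bochner_integral] is carried
    through linear combinations, bounded linear maps and left translations, and [bochner_integralE]
    turns it into an equation. Witnesses are needed for integrands with values in A and in L^p
    alike, hence the integrals are constructed over any normed space E that is [seq_complete].
    Completeness of [bop E] in the same sense serves for the extension rho. Strong continuity of v
    and alpha controls one variable at a time. The integrands F(g, h) are nevertheless jointly
    continuous, because alpha_g is isometric and |v_g| <= 1, which makes both families
    equicontinuous. Joint continuity and compact supports give, by the tube lemma, the uniform
    estimates behind the dependence on parameters and the exchange of integrals. *)

Section norm_convergence.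
Context {R : realType} {E : normedModType R[i]}.
Implicit Types (x y : E).

Lemma nrmB x y : nrm (x - y) = nrm (y - x).
Proof. by rewrite -nrmN opprB. Qed.

Lemma nrm_dist x y : `|nrm x - nrm y| <= nrm (x - y).
Proof.
rewrite ler_norml lerBlDr lerNl opprB lerBlDr.
have h u v : nrm u <= nrm (u - v) + nrm v by rewrite -{1}(subrK v u) ler_nrmD.
by rewrite h nrmB h.
Qed.

Lemma nrm_distD x y z : nrm (x - z) <= nrm (x - y) + nrm (y - z).
Proof. by rewrite -[x - z](subrKA y) ler_nrmD. Qed.

Lemma cvg_nrmP {T : Type} {F : set_system T} {FF : Filter F} (f : T -> E) l :
  f x @[x --> F] --> l <->
  forall e : R, 0 < e -> \forall x \near F, nrm (f x - l) < e.
Proof.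
split=> [/cvgrPdist_lt fl e e0|fl].
  have := fl e%:C; rewrite ltcR => /(_ e0); apply: filterS => x.
  by rewrite nrmE ltcR nrmB.
apply/cvgrPdist_lt => e; rewrite ltcE/= => /andP[/eqP ei e0].
apply: filterS (fl _ e0) => x; rewrite nrmE nrmB => xl.
by rewrite ltcE/= ei eqxx.
Qed.

Lemma cvg_nrm {T : Type} {F : set_system T} {FF : Filter F} (f : T -> E) l :
  f x @[x --> F] --> l -> nrm (f x) @[x --> F] --> nrm l.
Proof.
move=> /cvg_nrmP fl; apply/cvgrPdist_lt => e e0; apply: filterS (fl e e0) => x.
by apply: le_lt_trans; rewrite nrmB; exact: nrm_dist.
Qed.

Lemma cvg_nrm0 {T : Type} {F : set_system T} {FF : Filter F} (f : T -> E) l :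
  f x @[x --> F] --> l <-> nrm (f x - l) @[x --> F] --> (0 : R).
Proof.
split=> [/cvg_nrmP fl|/cvgrPdist_lt fl].
  apply/cvgrPdist_lt => e e0; apply: filterS (fl e e0) => x.
  by rewrite sub0r normrN ger0_norm ?nrm_ge0.
apply/cvg_nrmP => e e0; apply: filterS (fl e e0) => x.
by rewrite sub0r normrN ger0_norm ?nrm_ge0.
Qed.

Lemma cvg_to_nrm {T : Type} {F : set_system T} {FF : ProperFilter F}
    (f : T -> E) (l l' : E) : f x @[x --> F] --> l -> f x @[x --> F] --> l' -> l = l'.
Proof.
move=> /cvg_nrm0 fl /cvg_nrm0 fl'; apply/eqP; rewrite -subr_eq0; apply/eqP.
apply: nrm0_eq0; apply/le_anti; rewrite nrm_ge0 andbT.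
have h := cvgD fl fl'; rewrite addr0 in h; apply: (cvgr_to_ge (h _)).
by apply: nearW => x; rewrite fctE (nrmB (f x) l) nrm_distD.
Qed.

End norm_convergence.

Section linear_maps.
Context {R : realType} {E F : lmodType R[i]}.

Lemma linearfB (T : E -> F) : linear T -> {morph T : x y / x - y}.
Proof. by move=> lT x y; rewrite -scaleN1r addrC lT scaleN1r addrC. Qed.

Lemma linearf0 (T : E -> F) : linear T -> T 0 = 0.
Proof. by move=> lT; rewrite -(subrr 0) linearfB// subrr. Qed.

Lemma linearfD (T : E -> F) : linear T -> {morph T : x y / x + y}.
Proof. by move=> lT x y; rewrite -{1}(scale1r x) lT scale1r. Qed.

Lemma linearfZ (T : E -> F) : linear T -> forall c, {morph T : x / c *: x}.
Proof. by move=> lT c x; rewrite -{1}(addr0 (c *: x)) lT linearf0// addr0. Qed.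

End linear_maps.

Lemma bounded_linear_cvg {R : realType} {E F : normedModType R[i]}
    (T : E -> F) (M : R) : linear T ->
  (forall x, nrm (T x) <= M * nrm x) ->
  forall I (G : set_system I) (FG : Filter G) (f : I -> E) l,
  f x @[x --> G] --> l -> T (f x) @[x --> G] --> T l.
Proof.
move=> lT bT I G FG f l /cvg_nrm0 fl; apply/cvg_nrm0.
have h : M * nrm (f x - l) @[x --> G] --> (0 : R).
  by rewrite -(mulr0 M); apply: cvgM => //; exact: cvg_cst.
apply: (squeeze_cvgr _ (cvg_cst (0 : R)) h); apply: nearW => x.
by rewrite nrm_ge0 -linearfB// bT.
Qed.

Lemma linear_bound_continuous {R : realType} {E F : normedModType R[i]}
    (T : E -> F) (M : R) :
  linear T -> (forall x, nrm (T x) <= M * nrm x) -> continuous T.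
Proof. by move=> lT bT x; apply: (bounded_linear_cvg lT bT); exact: cvg_id. Qed.

(** * Simple functions and strong measurability *)

Section simple_functions.
Context {R : realType} {d : measure_display} {T : measurableType d}.
Context {E : normedModType R[i]}.
Variable nu : {measure set T -> \bar R}.
Implicit Types (s t : seq (set T * E)).

Definition measurable_steps s := forall Ae, Ae \in s -> measurable Ae.1.

Lemma simple_fct_nil x : simple_fct (R := R) (E := E) [::] (x : T) = 0.
Proof. exact: big_nil. Qed.

Lemma simple_fct_cons A (e : E) s (x : T) :
  simple_fct ((A, e) :: s) x = (if x \in A then e else 0) + simple_fct s x.
Proof.
rewrite /simple_fct big_cons/= indicE.
by case: ifP => _; rewrite ?rmorph1 ?scale1r// rmorph0 scale0r.
Qed.

Lemma simple_fct_cat s t (x : T) :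
  simple_fct (s ++ t) x = simple_fct s x + simple_fct t x.
Proof. exact: big_cat. Qed.

Lemma simple_int_cat s t :
  simple_int nu (s ++ t) = simple_int nu s + simple_int nu t.
Proof. exact: big_cat. Qed.

Lemma measurable_nrm_step s (e : E) : measurable_steps s ->
  measurable_fun setT (fun x => nrm (e + simple_fct s x)).
Proof.
elim: s e => [|[A e'] s IH] e ms.
  by rewrite (_ : (fun _ => _) = cst (nrm e))//; apply/funext => x;
    rewrite simple_fct_nil addr0.
have mA : measurable A by apply: (ms (A, e')); rewrite inE eqxx.
have ms' : measurable_steps s by move=> Ae h; apply: ms; rewrite inE h orbT.
rewrite (_ : (fun _ => _) = fun x => if x \in A then nrm (e + e' + simple_fct s x)
   else nrm (e + simple_fct s x)); last first.
  apply/funext => x; rewrite simple_fct_cons.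
  by case: (x \in A); rewrite ?add0r ?addrA.
apply: measurable_fun_ifT; [|exact: IH|exact: IH].
apply: (measurable_fun_bool true); rewrite setTI (_ : _ @^-1` _ = A)//.
by apply/seteqP; split=> x /=; [move/set_mem|move/mem_set].
Qed.

(* The constant [e] makes the induction on the steps go through: splitting [D]
   along the first set A adds its value to [e] on D `&` A only, so that the steps
   need not be disjoint. *)
Lemma le_simple_int_in s (e : E) D : measurable D -> (nu D < +oo)%E ->
  measurable_steps s ->
  ((nrm ((fine (nu D))%:C *: e + \sum_(Ae <- s) (fine (nu (Ae.1 `&` D)))%:C *: Ae.2))%:E
   <= \int[nu]_(x in D) (nrm (e + simple_fct s x))%:E)%E.
Proof.
elim: s e D => [|[A e'] s IH] e D mD fD ms.
  under eq_integral do rewrite simple_fct_nil addr0.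
  rewrite big_nil addr0 integral_cst// nrmZ /= expr0n/= addr0 sqrtr_sqr ger0_norm ?fine_ge0//.
  by rewrite EFinM fineK ?ge0_fin_numE// muleC.
have mA : measurable A by apply: (ms (A, e')); rewrite inE eqxx.
have ms' : measurable_steps s by move=> Ae h; apply: ms; rewrite inE h orbT.
have mDA : measurable (D `&` A) by exact: measurableI.
have mDnA : measurable (D `\` A) by exact: measurableD.
have le_fin B : measurable B -> B `<=` D -> (nu B < +oo)%E.
  by move=> mB BD; apply: le_lt_trans fD; apply: le_measure => //; rewrite inE.
have split_nu B : measurable B ->
    fine (nu (B `&` D)) = fine (nu (B `&` (D `&` A))) + fine (nu (B `&` (D `\` A))).
  move=> mB; have finI D' : measurable D' -> D' `<=` D -> nu (B `&` D') \is a fin_num.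
    move=> mD' D'D; rewrite ge0_fin_numE//; apply: le_fin; first exact: measurableI.
    by move=> x [_ /D'D].
  rewrite -fineD; [|by apply: finI => //; exact: subIsetl
                   |by apply: finI => //; exact: subDsetl].
  congr fine; rewrite addeC setIDA setIA; apply: measureDI => //.
  exact: measurableI.
have IH1 := IH (e + e') _ mDA (le_fin _ mDA (@subIsetl _ _ _)) ms'.
have IH2 := IH e _ mDnA (le_fin _ mDnA (@subDsetl _ _ _)) ms'.
apply: (@le_trans _ _ (\int[nu]_(x in D `&` A) (nrm (e + e' + simple_fct s x))%:E
  + \int[nu]_(x in D `\` A) (nrm (e + simple_fct s x))%:E)%E); last first.
  rewrite -[in leRHS](setUIDK D A) ge0_integral_setU//=; last 3 first.
  - rewrite setUIDK; apply/measurable_EFinP/measurable_funTS.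
    exact: measurable_nrm_step.
  - by move=> x _; rewrite lee_fin nrm_ge0.
  - by apply/disj_set2P/seteqP; split=> // x [[_ Ax] [_ /(_ Ax)]].
  rewrite le_eqVlt; apply/orP; left; apply/eqP; congr (_ + _)%E; apply: eq_integral => x.
    by rewrite inE => -[_ Ax]; rewrite simple_fct_cons mem_set// addrA.
  by rewrite inE => -[_ Ax]; rewrite simple_fct_cons memNset// add0r.
apply: le_trans (leeD IH1 IH2); rewrite -EFinD lee_fin.
apply: le_trans (ler_nrmD _ _); rewrite le_eqVlt; apply/orP; left; apply/eqP; congr nrm.
have sE : \sum_(Ae <- s) (fine (nu (Ae.1 `&` D)))%:C *: Ae.2 =
  \sum_(Ae <- s) (fine (nu (Ae.1 `&` (D `&` A))))%:C *: Ae.2 +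
  \sum_(Ae <- s) (fine (nu (Ae.1 `&` (D `\` A))))%:C *: Ae.2.
  rewrite -big_split/=; apply: eq_big_seq => -[B e''] Bs /=.
  by rewrite split_nu ?rmorphD ?scalerDl//; exact: (ms' _ Bs).
rewrite big_cons/= sE -{1}(setTI D) split_nu// !setTI scalerDr rmorphD scalerDl.
rewrite [A `&` D]setIC.
set a := _ *: e; set b := _ *: e; set c := _ *: e'; set u := \sum_(_ <- _) _.
set w := \sum_(_ <- _) _.
by rewrite -!addrA (addrCA b c) (addrCA b u).
Qed.

Lemma simple_steps s : simple_integrable nu s -> measurable_steps s.
Proof. by move=> si Ae /si[]. Qed.

(** [le_simple_int_in] with constant term 0, on the union D of the sets of [s]: D has finite measure
    by subadditivity, and intersecting a set of [s] with D changes nothing. *)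
Lemma le_simple_int s : simple_integrable nu s ->
  ((nrm (simple_int nu s))%:E <= \int[nu]_x (nrm (simple_fct s x))%:E)%E.
Proof.
move=> si; have ms := simple_steps si; pose D := \big[setU/set0]_(Ae <- s) Ae.1.
have mD : measurable D.
  by rewrite /D big_seq; apply: bigsetU_measurable => Ae /ms.
have fD : (nu D < +oo)%E.
  move: si; rewrite /D; elim: (s) => [|Ae s' IH] si; first by rewrite big_nil measure0.
  have si' : simple_integrable nu s' by move=> Be h; apply: si; rewrite inE h orbT.
  have [mA fA] := si Ae (mem_head _ _).
  have mD' : measurable (\big[setU/set0]_(Be <- s') Be.1).
    by rewrite big_seq; apply: bigsetU_measurable => Be /si'[].
  rewrite big_cons; apply: le_lt_trans (measureU2 _ _ _) _ => //.
  by rewrite lte_add_pinfty// IH.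
have := le_simple_int_in 0 mD fD ms; rewrite scaler0 add0r.
have -> : \sum_(Ae <- s) (fine (nu (Ae.1 `&` D)))%:C *: Ae.2 = simple_int nu s.
  apply: eq_big_seq => -[A e] As /=; rewrite setIidl// /D.
  by rewrite (big_rem _ As)/=; left.
under eq_integral do rewrite add0r.
move/le_trans; apply; apply: ge0_subset_integral => //.
- apply/measurable_EFinP; have := measurable_nrm_step 0 ms.
  by under eq_fun do rewrite add0r.
- by move=> x _; rewrite lee_fin nrm_ge0.
Qed.

(** The sets may have infinite measure: the class only has to make norms measurable and to be stable
    under differences, so that integrals of norms of f - s_n can be compared. *)
Definition strongly_measurable (f : T -> E) := exists s : nat -> seq (set T * E),
  (forall n, measurable_steps (s n)) /\
  (forall x, simple_fct (s n) x @[n --> \oo] --> f x).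

Lemma strongly_measurable_nrm f : strongly_measurable f ->
  measurable_fun setT (nrm \o f).
Proof.
move=> [s [ms sf]].
apply: (@measurable_fun_cvg _ _ _ _ (fun n x => nrm (simple_fct (s n) x))) => [n|x _].
  have := measurable_nrm_step 0 (ms n).
  by under eq_fun do rewrite add0r.
exact: cvg_nrm.
Qed.

Lemma strongly_measurable_simple s : measurable_steps s ->
  strongly_measurable (simple_fct s).
Proof. by move=> ms; exists (fun=> s); split=> // x; exact: cvg_cst. Qed.

End simple_functions.

Section scaled_steps.
Context {R : realType} {d : measure_display} {T : measurableType d}.
Variable nu : {measure set T -> \bar R}.

(** The values may lie in any type. With points of the group as values, [s] is a partition with one
    sample point per piece, and each function h on the group turns it into a simple function. *)
Definition map_steps {I J : Type} (h : I -> J) (s : seq (set T * I)) :=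
  [seq (Ae.1, h Ae.2) | Ae <- s].

Context {E F : normedModType R[i]}.

Lemma simple_fct_map (h : E -> F) s x : linear h ->
  simple_fct (map_steps h s) (x : T) = h (simple_fct s x).
Proof.
move=> lh; rewrite /simple_fct big_map/=; elim/big_rec2: _ => [|Ae y z _ ->].
  by rewrite linearf0.
by rewrite lh.
Qed.

Lemma simple_int_map (h : E -> F) s : linear h ->
  simple_int nu (map_steps h s) = h (simple_int nu s).
Proof.
move=> lh; rewrite /simple_int big_map/=; elim/big_rec2: _ => [|Ae y z _ ->].
  by rewrite linearf0.
by rewrite lh.
Qed.

Lemma simple_integrable_map (h : E -> F) s : simple_integrable nu s ->
  simple_integrable nu (map_steps h s).
Proof. by move=> si _ /mapP[Ae /si ? ->]. Qed.

Lemma simple_integrable_cat (s t : seq (set T * E)) : simple_integrable nu s ->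
  simple_integrable nu t -> simple_integrable nu (s ++ t).
Proof. by move=> si ti Ae; rewrite mem_cat => /orP[/si|/ti]. Qed.

Lemma measurable_steps_map (h : E -> F) (s : seq (set T * E)) :
  measurable_steps s -> measurable_steps (map_steps h s).
Proof. by move=> si _ /mapP[Ae /si ? ->]. Qed.

Lemma measurable_steps_cat (s t : seq (set T * E)) : measurable_steps s ->
  measurable_steps t -> measurable_steps (s ++ t).
Proof. by move=> si ti Ae; rewrite mem_cat => /orP[/si|/ti]. Qed.

End scaled_steps.

(** * Linearity, norm estimate and uniqueness of the Bochner integral *)

Section bochner_theory.
Context {R : realType} {d : measure_display} {T : measurableType d}.
Variable nu : {measure set T -> \bar R}.

Let linear_scale {E : normedModType R[i]} (c : R[i]) : linear ( *:%R c : E -> E).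
Proof. by move=> k x y; rewrite scalerDr !scalerA mulrC. Qed.

Lemma strongly_measurable_comb {E : normedModType R[i]} (c : R[i]) (f g : T -> E) :
  strongly_measurable f -> strongly_measurable g ->
  strongly_measurable (fun x => c *: f x + g x).
Proof.
move=> [s [ms sf]] [t [mt tg]].
exists (fun n => map_steps ( *:%R c) (s n) ++ t n); split=> [n|x].
  by apply: measurable_steps_cat => //; exact: measurable_steps_map.
under eq_fun do rewrite simple_fct_cat simple_fct_map//.
by apply: cvgD => //; apply: cvgZr.
Qed.

Lemma strongly_measurableB {E : normedModType R[i]} (f g : T -> E) :
  strongly_measurable f -> strongly_measurable g ->
  strongly_measurable (fun x => f x - g x).
Proof.
move=> mf mg; have := strongly_measurable_comb (-1) mg mf.
by under eq_fun do rewrite scaleN1r addrC.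
Qed.

Lemma strongly_measurable_map {E F : normedModType R[i]} (h : E -> F) (M : R) f :
  linear h -> (forall x, nrm (h x) <= M * nrm x) ->
  strongly_measurable f -> strongly_measurable (fun x : T => h (f x)).
Proof.
move=> lh bh [s [ms sf]]; exists (fun n => map_steps h (s n)); split=> [n|x].
  exact: measurable_steps_map.
under eq_fun do rewrite simple_fct_map//.
exact: (bounded_linear_cvg lh bh).
Qed.

Lemma is_bochner_measurable {E : normedModType R[i]} (f : T -> E) I :
  is_bochner_integral nu f I -> strongly_measurable f.
Proof.
by move=> [s [si sf _ _]]; exists s; split=> // n; exact: simple_steps (si n).
Qed.

Lemma measurable_EFin_nrm {E : normedModType R[i]} (f : T -> E) :
  strongly_measurable f -> measurable_fun setT (fun x => (nrm (f x))%:E).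
Proof. by move=> mf; apply/measurable_EFinP; exact: strongly_measurable_nrm mf. Qed.

Let nrmE_ge0 {E : normedModType R[i]} (f : T -> E) x : (0 <= (nrm (f x))%:E)%E.
Proof. by rewrite lee_fin nrm_ge0. Qed.

Lemma le_integral_nrm {E F : normedModType R[i]} (f : T -> E) (g : T -> F) (M : R) :
  strongly_measurable f -> strongly_measurable g -> 0 <= M ->
  (forall x, nrm (f x) <= M * nrm (g x)) ->
  (\int[nu]_x (nrm (f x))%:E <= M%:E * \int[nu]_x (nrm (g x))%:E)%E.
Proof.
move=> mf mg M0 fg; rewrite -ge0_integralZl_EFin//; last exact: measurable_EFin_nrm.
apply: ge0_le_integral => //; first exact: measurable_EFin_nrm.
  by apply: emeasurable_funM => //; exact: measurable_EFin_nrm.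
by move=> x _; rewrite -EFinM lee_fin.
Qed.

Lemma le_integral_nrmD {E : normedModType R[i]} (f g h : T -> E) :
  strongly_measurable f -> strongly_measurable g -> strongly_measurable h ->
  (forall x, nrm (h x) <= nrm (f x) + nrm (g x)) ->
  (\int[nu]_x (nrm (h x))%:E <=
   \int[nu]_x (nrm (f x))%:E + \int[nu]_x (nrm (g x))%:E)%E.
Proof.
move=> mf mg mh fg.
rewrite -ge0_integralD//; [|exact: measurable_EFin_nrm|exact: measurable_EFin_nrm].
apply: ge0_le_integral => //; first exact: measurable_EFin_nrm.
  by apply: emeasurable_funD; exact: measurable_EFin_nrm.
by move=> x _; rewrite -EFinD lee_fin.
Qed.

(** Steps may overlap, so the concatenation of the scaled steps of f with those of g represents c
    s_n + t_n without a common refinement. The error is at most |c| times that for f plus that for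
    g. *)
Lemma is_bochner_comb {E : normedModType R[i]} (c : R[i]) (f g : T -> E) I J :
  is_bochner_integral nu f I -> is_bochner_integral nu g J ->
  is_bochner_integral nu (fun x => c *: f x + g x) (c *: I + J).
Proof.
move=> hf hg; have mf := is_bochner_measurable hf; have mg := is_bochner_measurable hg.
move: hf hg => [s [si sf s0 sI]] [t [ti tg t0 tJ]].
exists (fun n => map_steps ( *:%R c) (s n) ++ t n); split=> [n|x||].
- by apply: simple_integrable_cat => //; exact: simple_integrable_map.
- under eq_fun do rewrite simple_fct_cat simple_fct_map//.
  by apply: cvgD => //; apply: cvgZr.
- have mfs n := strongly_measurableB mf (strongly_measurable_simple (simple_steps (si n))).
  have mgt n := strongly_measurableB mg (strongly_measurable_simple (simple_steps (ti n))).
  have h : ((normc c)%:E * \int[nu]_x (nrm (f x - simple_fct (s n) x))%:E +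
      \int[nu]_x (nrm (g x - simple_fct (t n) x))%:E)%E @[n --> \oo] --> 0%E.
    rewrite -[X in _ --> X]adde0 -{1}(mule0 (normc c)%:E).
    by apply: cvgeD => //; apply: cvgeZl.
  apply: (squeeze_cvge _ (cvg_cst _) h); apply: nearW => n.
  rewrite integral_ge0/=; last by move=> x _; rewrite lee_fin nrm_ge0.
  have mcf : strongly_measurable (fun x => c *: (f x - simple_fct (s n) x)).
    by apply: (strongly_measurable_map (M := normc c)) => // x; rewrite nrmZ.
  apply: le_trans (leeD (le_integral_nrm mcf (mfs n) (normc_ge0 c) _) (lexx _)).
    apply: le_integral_nrmD => // [|x].
      apply: strongly_measurableB; first exact: strongly_measurable_comb.
      apply: strongly_measurable_simple; apply: measurable_steps_cat.
        by apply: measurable_steps_map; exact: simple_steps (si n).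
      exact: simple_steps (ti n).
    rewrite simple_fct_cat simple_fct_map// opprD addrACA -scalerBr.
    exact: ler_nrmD.
  by move=> x; rewrite nrmZ.
- have -> : (fun n => simple_int nu (map_steps ( *:%R c) (s n) ++ t n)) =
     fun n => c *: simple_int nu (s n) + simple_int nu (t n).
    by apply/funext => n; rewrite simple_int_cat simple_int_map.
  by apply: cvgD => //; apply: cvgZr.
Qed.

Lemma is_bochner_map {E F : normedModType R[i]} (h : E -> F) (M : R) f I :
  linear h -> (forall x, nrm (h x) <= M * nrm x) ->
  is_bochner_integral nu f I -> is_bochner_integral nu (fun x : T => h (f x)) (h I).
Proof.
move=> lh bh hf; have mf := is_bochner_measurable hf.
move: hf => [s [si sf s0 sI]].
(* M may be negative when E is zero, whereas [le_integral_nrm] asks for a nonnegative constant. *)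
have bh' x : nrm (h x) <= Num.max M 0 * nrm x.
  by apply: le_trans (bh x) _; rewrite ler_wpM2r ?nrm_ge0// le_max lexx.
exists (fun n => map_steps h (s n)); split=> [n|x||].
- exact: simple_integrable_map.
- under eq_fun do rewrite simple_fct_map//.
  exact: (bounded_linear_cvg lh bh).
- have mfs n := strongly_measurableB mf (strongly_measurable_simple (simple_steps (si n))).
  have k : ((Num.max M 0)%:E * \int[nu]_x (nrm (f x - simple_fct (s n) x))%:E)%E
      @[n --> \oo] --> 0%E.
    by rewrite -[X in _ --> X](mule0 (Num.max M 0)%:E); apply: cvgeZl.
  apply: (squeeze_cvge _ (cvg_cst _) k); apply: nearW => n.
  rewrite integral_ge0/=; last by move=> x _; rewrite lee_fin nrm_ge0.
  have hE x : h (f x) - simple_fct (map_steps h (s n)) x = h (f x - simple_fct (s n) x).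
    by rewrite simple_fct_map// linearfB.
  under eq_integral do rewrite hE.
  apply: le_integral_nrm => //; first exact: (strongly_measurable_map (M := M)).
  by rewrite le_max lexx orbT.
- have -> : (fun n => simple_int nu (map_steps h (s n))) =
     fun n => h (simple_int nu (s n)) by apply/funext => n; rewrite simple_int_map.
  exact: (bounded_linear_cvg lh bh).
Qed.

(** Limit of |I_n| <= int |s_n| <= int |f| + int |f - s_n|, where I_n is the integral of the simple
    function s_n. *)
Lemma is_bochner_le {E : normedModType R[i]} (f : T -> E) I :
  is_bochner_integral nu f I -> ((nrm I)%:E <= \int[nu]_x (nrm (f x))%:E)%E.
Proof.
move=> hf; have mf := is_bochner_measurable hf.
move: hf => [s [si sf s0 sI]].
have h1 : (nrm (simple_int nu (s n)))%:E @[n --> \oo] --> (nrm I)%:E.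
  by apply: cvg_EFin; [exact: nearW|exact: cvg_nrm].
have h2 : (\int[nu]_x (nrm (f x))%:E + \int[nu]_x (nrm (f x - simple_fct (s n) x))%:E)%E
    @[n --> \oo] --> (\int[nu]_x (nrm (f x))%:E + 0)%E.
  by apply: cvgeD => //; [rewrite fin_num_adde_defl|exact: cvg_cst].
rewrite -[leRHS]adde0; apply: (lee_cvg_to h1 h2); apply: nearW => n.
apply: le_trans (le_simple_int (si n)) _.
have ms := strongly_measurable_simple (simple_steps (si n)).
apply: le_integral_nrmD => // [|x]; first exact: strongly_measurableB.
rewrite -{1}(subKr (f x) (simple_fct (s n) x)).
by rewrite -[nrm (f x - simple_fct (s n) x)]nrmN ler_nrmD.
Qed.

Lemma is_bochner_le_bound {E : normedModType R[i]} (f : T -> E) I (D : set T) (c : R) :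
  measurable D -> (nu D < +oo)%E -> 0 <= c -> (forall x, nrm (f x) <= c) ->
  (forall x, ~ D x -> f x = 0) ->
  is_bochner_integral nu f I -> nrm I <= c * fine (nu D).
Proof.
move=> mD fD c0 fc f0 hf; have mf := is_bochner_measurable hf.
rewrite -lee_fin EFinM fineK ?ge0_fin_numE//.
apply: le_trans (is_bochner_le hf) _.
rewrite -integral_cst// [leRHS]integral_mkcond; apply: ge0_le_integral => //.
- exact: measurable_EFin_nrm.
- by apply/(measurable_restrictT _ mD); exact: measurable_cst.
move=> x _; rewrite patchE; case: ifPn => [_|/negP xD]; rewrite lee_fin//.
by rewrite f0 ?nrm0// => /mem_set.
Qed.

(** J - I is an integral of the zero function, so [is_bochner_le] bounds its norm by 0. *)
Lemma is_bochner_unique {E : normedModType R[i]} (f : T -> E) I J :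
  is_bochner_integral nu f I -> is_bochner_integral nu f J -> I = J.
Proof.
move=> hI hJ; have := is_bochner_comb (-1) hI hJ.
under eq_fun do rewrite scaleN1r addNr.
move/is_bochner_le; rewrite nrm0 integral0 lee_fin => h.
have /nrm0_eq0 : nrm (-1 *: I + J) = 0 by apply/le_anti; rewrite h nrm_ge0.
by rewrite scaleN1r addrC => /eqP; rewrite subr_eq0 => /eqP.
Qed.

Lemma bochner_integralE {E : normedModType R[i]} (f : T -> E) I :
  is_bochner_integral nu f I -> bochner_integral nu f = I.
Proof.
move=> hI; have := xgetPex 0 (ex_intro _ I hI); rewrite -/(bochner_integral nu f).
by move=> h; exact: is_bochner_unique h hI.
Qed.

End bochner_theory.

(** * Completeness of L^p *)

Section completeness.
Context {R : realType}.

(** Stated with sequences and the real-valued norm, so that it covers Banach algebras, [Lp] and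
    operators on [Lp] uniformly, without filters. *)
Definition seq_complete (E : normedModType R[i]) := forall u : nat -> E,
  (forall e : R, 0 < e -> exists n0 : nat,
     forall m n, (n0 <= m)%N -> (n0 <= n)%N -> nrm (u m - u n) < e) ->
  exists l : E, u n @[n --> \oo] --> l.

Lemma exists_half_lt (e : R) : 0 < e -> exists k : nat, 2^-1 ^+ k < e.
Proof.
move=> e0; have h : (2^-1 : R) ^+ k @[k --> \oo] --> 0.
  by apply: cvg_expr; rewrite ger0_norm ?invr_ge0// invf_lt1// ltr1n.
have /cvgrPdist_lt /(_ e e0) [k _ hk] := h.
exists k; have := hk k (leqnn _); by rewrite /= sub0r normrN ger0_norm// exprn_ge0// invr_ge0.
Qed.

(** A Cauchy sequence has a subsequence of this rapid kind, and it converges to the limit of that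
    subsequence. *)
Lemma seq_complete_rapid (E : normedModType R[i]) :
  (forall u : nat -> E, (forall n m, (n <= m)%N -> nrm (u m - u n) <= 2^-1 ^+ n) ->
     exists l : E, u n @[n --> \oo] --> l) ->
  seq_complete E.
Proof.
move=> rapid u cu.
have /choice[n0 hn0] k : exists n0 : nat, forall m n, (n0 <= m)%N -> (n0 <= n)%N ->
    nrm (u m - u n) < 2^-1 ^+ k.
  by apply: cu; rewrite exprn_gt0// invr_gt0.
(* The chosen ranks n0 need not increase with k; their running maximum does. *)
pose N k := \max_(j < k.+1) n0 j.
have N0 k : (n0 k <= N k)%N by exact: (leq_bigmax (@ord_max k)).
have Nm k l : (k <= l)%N -> (N k <= N l)%N.
  move=> kl; apply/bigmax_leqP => j _;
  have jl : (j < l.+1)%N by exact: leq_trans (ltn_ord j) _.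
  exact: (leq_bigmax (Ordinal jl)).
have [|l hl] := rapid (u \o N).
  move=> n m nm /=; apply/ltW/hn0; last exact: N0.
  by apply: leq_trans (N0 n) _; exact: Nm.
exists l; apply/cvg_nrmP => e e0.
have e2 : 0 < e / 2 by rewrite divr_gt0.
have [k hk] := exists_half_lt e2.
move/cvg_nrmP/(_ _ e2) : hl => [k' _ hk'].
exists (n0 k) => // n /= kn.
pose j := maxn k k'.
rewrite (splitr e); apply: le_lt_trans (nrm_distD _ (u (N j)) _) _; apply: ltrD.
  apply: lt_trans hk; apply: hn0 => //; apply: leq_trans (N0 k) _; apply: Nm.
  exact: leq_maxl.
by apply: hk' => /=; exact: leq_maxr.
Qed.

Lemma banach_seq_complete (A : banachAlgType R[i]) : seq_complete A.
Proof.
move=> u cu; suff : cvgn u by move=> /cvg_ex[l ul]; exists l.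
apply: cauchy_cvg; apply/cauchyP => e; rewrite ltcE/= => /andP[/eqP ei e0].
have [n0 h] := cu _ e0; exists (u n0); exists n0 => // n n0n /=.
by rewrite -ball_normE /ball_/= nrmE ltcE/= ei eqxx/= h.
Qed.

End completeness.

Section real_powers.
Context {R : realType}.

(** At a > 0 continuity follows from the derivability of the power. At a = 0 it is seen directly: f
    t < e^(1/p) gives (f t)^p < e. *)
Lemma powR_cvg {T : Type} {F : set_system T} {FF : Filter F} (f : T -> R) (a p : R) :
  0 < p -> (forall t, 0 <= f t) -> f t @[t --> F] --> a -> 0 <= a ->
  f t `^ p @[t --> F] --> a `^ p.
Proof.
move=> p0 f0 fa a0; move: (a0); rewrite le_eqVlt => /predU1P[a0'|agt0].
  rewrite -a0' in fa *; rewrite powR0 ?gt_eqF//.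
  apply/cvgrPdist_lt => e e0.
  have /cvgrPdist_lt/(_ _ (powR_gt0 p^-1 e0)) := fa.
  apply: filterS => t; rewrite !sub0r !normrN !ger0_norm ?powR_ge0//.
  have eE : e = (e `^ p^-1) `^ p.
    by rewrite -powRrM mulVf ?gt_eqF// powRr1// ltW.
  by move=> h; rewrite eE; apply: gt0_ltr_powR => //; rewrite nnegrE// powR_ge0.
have ca : {for a, continuous (fun x : R => x `^ p)}.
  apply: differentiable_continuous; apply/derivable1_diffP.
  by apply: derivable_powR; rewrite in_itv/= agt0.
exact: (continuous_cvg _ ca fa).
Qed.

(* [u + G] and [G] are both nondecreasing and bounded. *)
Lemma cvg_of_variation (u G : nat -> R) (M : R) :
  (forall n, `|u n.+1 - u n| <= G n.+1 - G n) -> (forall n, G n <= M) ->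
  cvgn u.
Proof.
move=> uG GM.
have Gn n : G n <= G n.+1 by rewrite -subr_ge0; apply: le_trans (uG n).
have cG : cvgn G.
  apply: nondecreasing_is_cvgn; first by apply/nondecreasing_seqP.
  by exists M => _ [n _ <-].
have cuG : cvgn (u + G).
  apply: nondecreasing_is_cvgn.
    apply/nondecreasing_seqP => n; rewrite !fctE -subr_ge0 opprD addrACA.
    have := uG n; rewrite ler_norml => /andP[+ _].
    by rewrite lerNl -subr_ge0 opprK addrC.
  exists (u 0%N - G 0%N + M + M) => _ [n _ <-]; rewrite fctE lerD//.
  apply: (@le_trans _ _ (u 0%N - G 0%N + G n)); last by rewrite lerD2l.
  elim: n => [|n IH]; first by rewrite subrK.
  rewrite -(subrK (u n) (u n.+1)) -(subrK (G n) (G n.+1)) addrCA lerD//.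
  exact: le_trans (ler_norm _) (uG n).
rewrite (_ : u = (u + G) - G); last by rewrite addrK.
exact: is_cvgB.
Qed.

End real_powers.
Lemma ReB {R : realType} (a b : R[i]) : complex.Re (a - b) = complex.Re a - complex.Re b.
Proof. by case: a b => [? ?] []. Qed.

Lemma ImB {R : realType} (a b : R[i]) : complex.Im (a - b) = complex.Im a - complex.Im b.
Proof. by case: a b => [? ?] []. Qed.

Lemma normcE {R : realType} (a : R[i]) :
  normc a = Num.sqrt (complex.Re a ^+ 2 + complex.Im a ^+ 2).
Proof. by case: a. Qed.

(** * The Riesz-Fischer theorem for complex L^p *)

Section Lp_complete.
Context {R : realType} {d : measure_display} {X : measurableType d}.
Variables (mu : {measure set X -> \bar R}) (p : R) (p1 : 1 <= p).
Implicit Types f g : X -> R[i].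

Let p0 : 0 < p. Proof. exact: lt_le_trans ltr01 p1. Qed.

(** The p-th power of the seminorm: monotone convergence and Fatou apply to this integral, and
    [Lp_seminorm_leP] carries bounds back and forth. *)
Let Q f : \bar R := (\int[mu]_x ((normc (f x)) `^ p)%:E)%E.

Let Q_ge0 f : (0 <= Q f)%E.
Proof. by apply: integral_ge0 => x _; rewrite lee_fin powR_ge0. Qed.

Let Lp_seminormE f : Lp_seminorm mu p f = (Q f `^ p^-1)%E.
Proof.
rewrite /Lp_seminorm unlock; congr (_ `^ _)%E; apply: eq_integral => x _ /=.
by rewrite ger0_norm ?normc_ge0.
Qed.

Let Lp_seminorm_leP f (c : R) : 0 <= c ->
  (Lp_seminorm mu p f <= c%:E)%E <-> (Q f <= (c `^ p)%:E)%E.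
Proof.
move=> c0; rewrite Lp_seminormE.
have pV0 : 0 <= p^-1 by rewrite invr_ge0 ltW.
have in0 (y : \bar R) : (0 <= y)%E -> y \in `[0%E, +oo%E] by rewrite in_itv/= leey => ->.
split=> h.
  have -> : Q f = ((Q f `^ p^-1) `^ p)%E by rewrite -poweRrM mulVf ?gt_eqF// poweRe1.
  rewrite -poweR_EFin; apply: gt0_ler_poweR => //; [exact: ltW| |exact: in0].
  by apply: in0; exact: poweR_ge0.
have -> : c%:E = (((c `^ p)%:E) `^ p^-1)%E.
  by rewrite poweR_EFin -powRrM mulfV ?gt_eqF// powRr1.
by apply: gt0_ler_poweR => //; apply: in0 => //; rewrite lee_fin powR_ge0.
Qed.

Let measurable_parts f := measurable_fun setT (@complex.Re R \o f) /\
  measurable_fun setT (@complex.Im R \o f).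

Let measurable_pow f : measurable_parts f ->
  measurable_fun setT (fun x => ((normc (f x)) `^ p)%:E).
Proof.
move=> [mr mi]; apply/measurable_EFinP.
exact: (measurableT_comp (measurable_powR p) (measurable_normc mr mi)).
Qed.

Lemma Lp_fun_parts (f : Lp_fun mu p1) : measurable_parts f.
Proof. by have := Lp_fun_subproof f; rewrite inE => -[]. Qed.

Lemma Lp_seminorm_fun (f : Lp_fun mu p1) : Lp_seminorm mu p f = (Lp_fun_norm f)%:E.
Proof. exact/Lp_seminorm_fin/Lp_fun_subproof. Qed.

Section rapid.
Variable f : nat -> Lp_fun mu p1.
Hypothesis rapid : forall n m, (n <= m)%N -> Lp_fun_norm (f m - f n) <= 2^-1 ^+ n.

Let step n x : R := normc (f n.+1 x - f n x).
(** Dominates the variation of the sequence at x: once G n x is bounded in n, the sequence f n x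
    converges. *)
Let G n x : R := \sum_(k < n) step k x.

Let step_ge0 n x : 0 <= step n x. Proof. exact: normc_ge0. Qed.

Let G_ge0 n x : 0 <= G n x. Proof. exact: sumr_ge0. Qed.

Let GS n x : G n.+1 x = G n x + step n x. Proof. exact: big_ord_recr. Qed.

Let measurable_step n : measurable_fun setT (step n).
Proof. by have [mr mi] := Lp_fun_parts (f n.+1 - f n); exact: measurable_normc mr mi. Qed.

Let measurable_G n : measurable_fun setT (G n).
Proof. by apply: measurable_sum => k; exact: measurable_step. Qed.

(** Minkowski's inequality term by term; 2 - 2 * 2^-n is the sum of 2^-k for k < n. *)
Let normG n : ('N[mu]_p%:E[EFin \o G n] <= (2 - 2 * 2^-1 ^+ n)%:E)%E.
Proof.
elim: n => [|n IH].
  rewrite (_ : EFin \o _ = cst 0%E) ?Lnorm0//.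
    by rewrite expr0 mulr1 subrr.
  by rewrite gt_eqF.
  by apply/funext => x /=; rewrite /G big_ord0.
rewrite (_ : G n.+1 = G n \+ step n); last by apply/funext => x; rewrite /= GS.
apply: (le_trans (minkowski_EFin mu (measurable_G n) (measurable_step n) p1)).
have hs : ('N[mu]_p%:E[EFin \o step n] <= (2^-1 ^+ n)%:E)%E.
  rewrite (_ : EFin \o _ = EFin \o (@normc R \o (f n.+1 - f n : Lp_fun mu p1)))//.
  by rewrite -/(Lp_seminorm mu p _) Lp_seminorm_fun lee_fin rapid.
apply: le_trans (leeD IH hs) _; rewrite -EFinD lee_fin exprS.
by rewrite mulVKf// mulrDl mul1r opprD addrA subrK.
Qed.

Let intG n : (\int[mu]_x (G n x `^ p)%:E <= (2 `^ p)%:E)%E.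
Proof.
pose g x : R[i] := (G n x)%:C.
have gE x : normc (g x) = G n x.
  by rewrite /= expr0n/= addr0 sqrtr_sqr ger0_norm.
have : (Lp_seminorm mu p g <= 2%:E)%E.
  rewrite /Lp_seminorm (_ : _ \o g = G n); last by apply/funext => x; exact: gE.
  by apply: le_trans (normG n) _; rewrite lee_fin gerBl mulr_ge0// exprn_ge0.
by move/Lp_seminorm_leP => /(_ (ler0n _ _)); rewrite /Q; under eq_integral do rewrite gE.
Qed.

(* By monotone convergence Gp is integrable, hence finite almost everywhere;
   where it is finite, the sequence f converges pointwise. *)
Let Gp x : \bar R := limn (fun n => (G n x `^ p)%:E).

Let G_homo x : {homo (fun n => (G n x `^ p)%:E) : n m / (n <= m)%N >-> (n <= m)%E}.
Proof.
apply/nondecreasing_seqP => n; rewrite lee_fin; apply: ge0_ler_powR.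
- exact: ltW.
- by rewrite nnegrE.
- by rewrite nnegrE.
- by rewrite GS lerDl.
Qed.

Let measurable_GEFin n : measurable_fun setT (fun x => (G n x `^ p)%:E).
Proof.
apply/measurable_EFinP.
exact: (measurableT_comp (measurable_powR p) (measurable_G n)).
Qed.

Let measurable_Gp : measurable_fun setT Gp.
Proof.
apply: (@emeasurable_fun_cvg _ _ _ _ (fun n x => (G n x `^ p)%:E)) => // x _.
exact: ereal_nondecreasing_is_cvgn (G_homo x).
Qed.

Let Gp_ge0 x : (0 <= Gp x)%E.
Proof.
apply: lime_ge; first exact: ereal_nondecreasing_is_cvgn (G_homo x).
by apply: nearW => n; rewrite lee_fin powR_ge0.
Qed.

Let C := [set x | Gp x \is a fin_num].

Let measurable_C : measurable C.
Proof. by rewrite -[C]setTI; exact: emeasurable_fin_num. Qed.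

Let ae_C : {ae mu, forall x, C x}.
Proof.
have : mu.-integrable setT Gp.
  apply/integrableP; split=> //; under eq_integral do rewrite gee0_abs//.
  have h := @cvg_monotone_convergence _ _ _ mu _ measurableT
    (fun n x => (G n x `^ p)%:E) measurable_GEFin
    (fun n x _ => powR_ge0 _ _) (fun x _ => G_homo x).
  apply: (@le_lt_trans _ _ (2 `^ p)%:E); last exact: ltry.
  apply: (cvge_to_le h); apply: nearW => n; exact: intG.
by move=> /(integrable_ae measurableT); apply: filterS => x; apply.
Qed.

(** The increments of both parts are at most those of G, and G n x stays below (Gp x)^(1/p), which
    is finite on C. *)
Let cvg_f x : C x -> cvgn (fun n => complex.Re (f n x)) /\ cvgn (fun n => complex.Im (f n x)).
Proof.
move=> Cx; have GM n : G n x <= (fine (Gp x)) `^ p^-1.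
  have -> : G n x = (G n x `^ p) `^ p^-1 by rewrite -powRrM mulfV ?gt_eqF// powRr1.
  apply: ge0_ler_powR; rewrite ?nnegrE ?invr_ge0 ?(ltW p0) ?powR_ge0 ?fine_ge0//.
  rewrite -lee_fin fineK//.
  apply: (cvge_to_ge (ereal_nondecreasing_is_cvgn (G_homo x))).
  by exists n => // m nm; exact: G_homo.
have le_parts (z : R[i]) : `|complex.Re z| <= normc z /\ `|complex.Im z| <= normc z.
  case: z => a b /=; rewrite -!sqrtr_sqr; split; apply: ler_wsqrtr.
    by rewrite lerDl sqr_ge0.
  by rewrite lerDr sqr_ge0.
split; apply: (@cvg_of_variation _ _ (G ^~ x)) GM => n; rewrite GS (addrC (G n x)) addrK.
  by rewrite -ReB; have [] := le_parts (f n.+1 x - f n x).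
by rewrite -ImB; have [] := le_parts (f n.+1 x - f n x).
Qed.

(** The value 0 off C makes g an everywhere defined limit of measurable functions, the f n truncated
    to C, as membership in [Lp_pred] requires measurability on the whole space. *)
Let g x : R[i] := if x \in C then
  Complex (limn (fun n => complex.Re (f n x))) (limn (fun n => complex.Im (f n x))) else 0.

Let g_cvg x : C x -> complex.Re (f n x) @[n --> \oo] --> complex.Re (g x) /\
  complex.Im (f n x) @[n --> \oo] --> complex.Im (g x).
Proof. by move=> Cx; rewrite /g mem_set//=; exact: cvg_f. Qed.

Let measurable_truncated (h : X -> R) : measurable_fun setT h ->
  measurable_fun setT (fun x => if x \in C then h x else 0).
Proof.
move=> mh; apply: measurable_fun_ifT => //.
apply: (measurable_fun_bool true); rewrite setTI (_ : _ @^-1` _ = C)//.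
by apply/seteqP; split=> x /=; [move/set_mem|move/mem_set].
Qed.

Let g_parts : measurable_parts g.
Proof.
split.
  apply: (@measurable_fun_cvg _ _ _ _ (fun n x => if x \in C then complex.Re (f n x) else 0)).
    by move=> n; apply: measurable_truncated; have [] := Lp_fun_parts (f n).
  move=> x _; have [xC|xC] := boolP (x \in C).
    by have [] := g_cvg (set_mem xC).
  by rewrite /= /g (negbTE xC); exact: cvg_cst.
apply: (@measurable_fun_cvg _ _ _ _ (fun n x => if x \in C then complex.Im (f n x) else 0)).
  by move=> n; apply: measurable_truncated; have [] := Lp_fun_parts (f n).
move=> x _; have [xC|xC] := boolP (x \in C).
  by have [] := g_cvg (set_mem xC).
by rewrite /= /g (negbTE xC); exact: cvg_cst.
Qed.

Let fBg n : X -> R[i] := fun x => f n x - g x.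

Let fBg_parts n : measurable_parts (fBg n).
Proof.
have [fr fi] := Lp_fun_parts (f n); have [gr gi] := g_parts; split.
  rewrite (_ : _ \o _ = (@complex.Re R \o f n) \- (@complex.Re R \o g)).
    exact: measurable_funB.
  by apply/funext => x /=; rewrite ReB.
rewrite (_ : _ \o _ = (@complex.Im R \o f n) \- (@complex.Im R \o g)).
  exact: measurable_funB.
by apply/funext => x /=; rewrite ImB.
Qed.

Let fBg_cvg n x : C x -> (normc (f n x - f m x) `^ p)%:E @[m --> \oo] -->
  (normc (fBg n x) `^ p)%:E.
Proof.
move=> /g_cvg[gr gi]; apply: cvg_EFin; first exact: nearW.
apply: powR_cvg => //; [by move=> m; exact: normc_ge0| |exact: normc_ge0].
under eq_fun do rewrite normcE ReB ImB.
rewrite normcE ReB ImB; apply: (continuous_cvg _ (@sqrt_continuous _ _)).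
by apply: cvgD; rewrite !expr2; apply: cvgM; apply: cvgB => //; exact: cvg_cst.
Qed.

(** Fatou's lemma, as m tends to infinity, for |f n - f m|^p on C, whose complement is
    negligible. *)
Let Q_fBg n : (Q (fBg n) <= ((2^-1 ^+ n) `^ p)%:E)%E.
Proof.
have mC : measurable (~` C) by exact: measurableC.
have C0 : mu (~` C) = 0%E.
  by apply/(negligibleP _ mC); apply: negligibleS ae_C => x.
rewrite /Q (@ge0_negligible_integral _ _ _ mu setT (~` C))//; last 2 first.
- by apply: measurable_pow; exact: fBg_parts.
- by move=> x _; rewrite lee_fin powR_ge0.
rewrite setTD setCK.
pose h m x := (normc (f n x - f m x) `^ p)%:E.
have mh m : measurable_fun setT (h m).
  by have := measurable_pow (Lp_fun_parts (f n - f m)).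
have -> : (\int[mu]_(x in C) (normc (fBg n x) `^ p)%:E =
    \int[mu]_(x in C) limn_einf (h ^~ x))%E.
  apply: eq_integral => x /set_mem Cx.
  by have [->] := cvg_limn_einf_sup (@fBg_cvg n x Cx).
have := @fatou _ _ _ mu C measurable_C h (fun m => measurable_funTS (mh m))
  (fun m x _ => powR_ge0 _ _).
move/le_trans; apply; rewrite limn_einf_lim.
apply: lime_le; first by apply: ereal_nondecreasing_is_cvgn; exact: nondecreasing_einfs.
(* The infimum over the indices from m on is at most the value at [maxn m n], an index to which
   [rapid] applies because it is at least n. *)
apply: nearW => m; apply: (@le_trans _ _ (\int[mu]_(x in C) h (maxn m n) x)%E).
  by apply: ereal_inf_lbound; exists (maxn m n) => //=; exact: leq_maxl.
apply: (@le_trans _ _ (\int[mu]_x h (maxn m n) x)%E).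
  by apply: ge0_subset_integral => // x _; rewrite lee_fin powR_ge0.
pose F : Lp_fun mu p1 := f (maxn m n) - f n.
have hr : (Lp_seminorm mu p F <= (2^-1 ^+ n)%:E)%E.
  by rewrite Lp_seminorm_fun lee_fin; apply: rapid; exact: leq_maxr.
have e0 : 0 <= 2^-1 ^+ n :> R by rewrite exprn_ge0// invr_ge0.
have /(_ e0) [/(_ hr) + _] := @Lp_seminorm_leP F (2^-1 ^+ n).
apply: le_trans; rewrite le_eqVlt; apply/orP; left; apply/eqP.
apply: eq_integral => x _; congr (_ `^ _)%:E.
by rewrite -normcN opprB.
Qed.

Let fBg_Lp n : fBg n \in Lp_pred mu p.
Proof.
rewrite inE; have [? ?] := fBg_parts n; split=> //.
have e0 : 0 <= 2^-1 ^+ n :> R by rewrite exprn_ge0// invr_ge0.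
have /(_ e0) [_ /(_ (Q_fBg n)) h] := @Lp_seminorm_leP (fBg n) (2^-1 ^+ n).
exact: le_lt_trans h (ltry _).
Qed.

Lemma rapid_Lp_cvg : exists g : Lp_fun mu p1, forall n, Lp_fun_norm (f n - g) <= 2^-1 ^+ n.
Proof.
(* This is g itself, seen to be in L^p as the difference of f 0 and f 0 - g. *)
exists (f 0%N - LpFun p1 (fBg_Lp 0)) => n; rewrite -lee_fin -Lp_seminorm_fun.
have -> : Lp_fun_fun (f n - (f 0%N - LpFun p1 (fBg_Lp 0))) = fBg n.
  by apply/funext => x /=; rewrite /fBg !fctE subKr.
have e0 : 0 <= 2^-1 ^+ n :> R by rewrite exprn_ge0// invr_ge0.
by have [_] := Lp_seminorm_leP (fBg n) e0; apply; exact: Q_fBg.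
Qed.

End rapid.

Lemma Lp_seq_complete : seq_complete (Lp mu p1).
Proof.
apply: seq_complete_rapid => u hu; pose N := Lp_fun_seminorm mu p1.
pose f n : Lp_fun mu p1 := repr (u n : sepquot N).
have uE n : u n = sep_pi N (f n) by rewrite sep_piK.
have nrm_pi (a b : Lp_fun mu p1) : nrm (sep_pi N a - sep_pi N b) = Lp_fun_norm (a - b).
  by rewrite -scaleN1r -sep_piZ scaleN1r -sep_piD nrm_sep_pi.
have [n m nm|g hg] := @rapid_Lp_cvg f; first by rewrite -nrm_pi -!uE hu.
exists (sep_pi N g); apply/cvg_nrmP => e e0.
have [k hk] := exists_half_lt e0; exists k => // n /= kn.
rewrite uE nrm_pi; apply: le_lt_trans hk; apply: le_trans (hg n) _.
by apply: ler_wiXn2l => //; rewrite ?invr_ge0// invf_le1// ler1n.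
Qed.

End Lp_complete.

(** * Integration of compactly supported continuous functions *)

Section borel_sets.
Context {G : ptopologicalType}.

Lemma borel_open (U : set G) : open U -> measurable (U : set (borel G)).
Proof. by move=> oU; exact: sub_sigma_algebra. Qed.

Lemma borel_closed (K : set G) : closed K -> measurable (K : set (borel G)).
Proof.
move=> cK; rewrite -(setCK K); apply: measurableC; apply: borel_open.
exact: closed_openC.
Qed.

Lemma borel_compact (K : set G) : hausdorff_space G -> compact K ->
  measurable (K : set (borel G)).
Proof. by move=> hG cK; apply: borel_closed; exact: compact_closed. Qed.

Lemma borel_continuous (f : G -> G) : continuous f ->
  measurable_fun setT (f : borel G -> borel G).
Proof.
move=> cf; apply: (@measurability _ _ (borel G) (borel G) setT f (@open G)) => //.
move=> _ [U oU <-]; rewrite setTI; apply: borel_open.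
by apply: open_comp => // x _; exact: cf.
Qed.

(** Each piece keeps the index x of the set U x it is cut from; the point x itself need not lie in
    the piece. *)
Fixpoint disjoint_pieces (U : G -> set G) (xs : seq G) (B : set (borel G)) :=
  if xs is x :: xs' then (B `&` U x, x) :: disjoint_pieces U xs' (B `\` U x)
  else [::].

(** The point x' is the first index in [xs] whose set contains y, hence in general not x. It is
    fixed before E and h, so that one partition serves a whole family of functions. *)
Lemma disjoint_piecesP {R : realType} (U : G -> set G) (xs : seq G) (B : set (borel G)) :
  (forall x, open (U x)) -> measurable B ->
  [/\ forall Ax, Ax \in disjoint_pieces U xs B -> measurable Ax.1 /\ Ax.1 `<=` B,
     forall y, ~ B y -> forall (E : normedModType R[i]) (h : G -> E),
       simple_fct (map_steps h (disjoint_pieces U xs B)) y = 0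
   & forall y x, B y -> x \in xs -> U x y ->
       exists2 x', U x' y & forall (E : normedModType R[i]) (h : G -> E),
         simple_fct (map_steps h (disjoint_pieces U xs B)) y = h x'].
Proof.
move=> oU; elim: xs B => [|x xs IH] B mB.
  by split=> // y _ E h; exact: simple_fct_nil.
have mU : measurable (U x : set (borel G)) by exact: borel_open.
have [IH1 IH2 IH3] := IH (B `\` U x) (measurableD mB mU); split.
- move=> Ax; rewrite inE => /predU1P[->/=|/IH1[mA AB]].
    by split; [exact: measurableI|move=> y []].
  by split=> // y /AB[].
- move=> y By E h; rewrite /= simple_fct_cons memNset; last by case.
  by rewrite add0r IH2//; case.
move=> y x' By; have [Uxy|Uxy] := pselect (U x y).
  move=> _ _; exists x => // E h; rewrite /= simple_fct_cons mem_set//.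
  by rewrite IH2 ?addr0//; case.
rewrite inE => /predU1P[->//|x'xs Ux'y].
have [//|x'' Ux'' IHE] := IH3 y x' _ x'xs Ux'y; exists x'' => // E h.
by rewrite /= simple_fct_cons memNset ?add0r ?IHE//; case.
Qed.

(** A finite subcover by the interiors of the V x, made disjoint inside K. *)
Lemma compact_partition {R : realType} (K : set G) (V : G -> set G) :
  measurable (K : set (borel G)) -> compact K -> (forall x, K x -> nbhs x (V x)) ->
  exists s : seq (set (borel G) * G),
  [/\ forall Ax, Ax \in s -> measurable Ax.1 /\ Ax.1 `<=` K,
     forall y, ~ K y -> forall (E : normedModType R[i]) (h : G -> E),
       simple_fct (map_steps h s) y = 0
   & forall y, K y -> exists2 x, V x y &
       forall (E : normedModType R[i]) (h : G -> E), simple_fct (map_steps h s) y = h x].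
Proof.
move=> mK; rewrite compact_cover => cK nV.
have [|D _ KD] := cK G K (fun x => (V x)^°) (fun x _ => @open_interior _ (V x)).
  by move=> x Kx; exists x => //; exact: nV.
have [h1 h2 h3] := @disjoint_piecesP R (fun x => (V x)^°) (enum_fset D) K
  (fun x => @open_interior _ _) mK.
exists (disjoint_pieces (fun x => (V x)^°) (enum_fset D) K); split=> // y Ky.
have [x xD Vxy] := KD y Ky.
by have [x' /interior_subset Vx'] := h3 y x Ky xD Vxy; exists x'.
Qed.

End borel_sets.

Section compactly_supported_integrals.
Context {R : realType} {G : topologicalGroupType}.
Hypothesis hG : hausdorff_space G.
Variable nu : {measure set (borel G) -> \bar R}.
Hypothesis haar : left_haar nu.

Let vol (K : set G) : R := fine (nu K).

Let vol_ge0 K : 0 <= vol K. Proof. exact/fine_ge0/measure_ge0. Qed.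

Lemma is_bochner_simple {E : normedModType R[i]} (s : seq (set (borel G) * E)) :
  simple_integrable nu s -> is_bochner_integral nu (simple_fct s) (simple_int nu s).
Proof.
move=> si; exists (fun=> s); split=> // [x||]; [exact: cvg_cst| |exact: cvg_cst].
under eq_fun do under eq_integral do rewrite subrr nrm0.
by rewrite integral0; exact: cvg_cst.
Qed.

Lemma is_bochner0 {E : normedModType R[i]} :
  is_bochner_integral nu (fun=> 0 : E) 0.
Proof.
have := @is_bochner_simple E [::]; rewrite /simple_int big_nil.
rewrite (_ : simple_fct [::] = fun=> 0); first by apply => ?.
by apply/funext => ?; exact: simple_fct_nil.
Qed.

Lemma is_bochnerB {E : normedModType R[i]} (f g : G -> E) I J :
  is_bochner_integral nu f I -> is_bochner_integral nu g J ->
  is_bochner_integral nu (fun x => f x - g x) (I - J).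
Proof.
move=> hf hg; have := is_bochner_comb (-1) hg hf.
by under eq_fun do rewrite scaleN1r addrC; rewrite scaleN1r addrC.
Qed.

Section compact_support.
Variable K : set G.
Hypothesis cK : compact K.

Let mK : measurable (K : set (borel G)). Proof. exact: borel_compact. Qed.

Let nuK : (nu K < +oo)%E. Proof. exact: haar_compact haar _ cK. Qed.

Lemma le_bochner_compact {E : normedModType R[i]} (f : G -> E) I (e : R) :
  is_bochner_integral nu f I -> 0 <= e -> (forall x, K x -> nrm (f x) <= e) ->
  (forall x, ~ K x -> f x = 0) -> nrm I <= e * vol K.
Proof.
move=> hf e0 fe f0; apply: is_bochner_le_bound hf => // x.
by have [/fe//|/f0 ->] := pselect (K x); rewrite nrm0.
Qed.

Lemma le_bochner_dist {E : normedModType R[i]} (f g : G -> E) I J (e : R) :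
  is_bochner_integral nu f I -> is_bochner_integral nu g J -> 0 <= e ->
  (forall x, K x -> nrm (f x - g x) <= e) ->
  (forall x, ~ K x -> f x = 0) -> (forall x, ~ K x -> g x = 0) ->
  nrm (I - J) <= e * vol K.
Proof.
move=> hf hg e0 fg f0 g0; apply: le_bochner_compact (is_bochnerB hf hg) e0 fg _ => x Kx.
by rewrite f0// g0// subrr.
Qed.

Lemma simple_integrable_sub {E : normedModType R[i]}
    (s : seq (set (borel G) * G)) (h : G -> E) :
  (forall Ax, Ax \in s -> measurable Ax.1 /\ Ax.1 `<=` K) ->
  simple_integrable nu (map_steps h s).
Proof.
move=> hs _ /mapP[Ax /hs[mA AK] ->]; split=> //=.
by apply: le_lt_trans nuK; apply: le_measure => //; rewrite inE.
Qed.

(** Sampling f on a fine partition of K gives simple functions within 2^-n of f everywhere and zero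
    off K. Since nu(K) is finite, their integrals form a Cauchy sequence. *)
Lemma bochner_compact_exists {E : normedModType R[i]} (f : G -> E) :
  seq_complete E -> continuous f -> (forall x, ~ K x -> f x = 0) ->
  exists I, is_bochner_integral nu f I.
Proof.
move=> Ecomplete cf f0.
have half_gt0 n : 0 < (2^-1 : R) ^+ n by rewrite exprn_gt0// invr_gt0.
have half_ge0 n := ltW (half_gt0 n).
have /choice[s hs] n : exists s : seq (set (borel G) * E),
    [/\ simple_integrable nu s, forall x, ~ K x -> simple_fct s x = 0
      & forall x, nrm (f x - simple_fct s x) <= 2^-1 ^+ n].
  have [|s [s1 s2 s3]] := @compact_partition G R K
    (fun x => [set y | nrm (f y - f x) < 2^-1 ^+ n]) mK cK.
    by move=> x _; have /cvg_nrmP := cf x; exact.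
  exists (map_steps f s); split=> [|x Kx|x].
  - exact: simple_integrable_sub.
  - exact: s2.
  - have [/s3[y yx ->]|Kx] := pselect (K x); first exact: ltW.
    by rewrite f0// s2// subrr nrm0.
have [|I hI] := Ecomplete (fun n => simple_int nu (s n)).
  (* Two simple functions, each within 2^-k of f, differ by at most 2 * 2^-k on K; the added 1 keeps
     the divisor positive when K is null. *)
  move=> e e0; have k0 : 0 < vol K + vol K + 1 by rewrite ltr_wpDl// addr_ge0.
  have [k hk] := exists_half_lt (divr_gt0 e0 k0).
  exists k => m n km kn; rewrite ltr_pdivlMr// in hk.
  have [sm zm dm] := hs m; have [sn zn dn] := hs n.
  have le_k j : (k <= j)%N -> (2^-1 : R) ^+ j <= 2^-1 ^+ k.
    by move=> kj; apply: ler_wiXn2l => //; rewrite ?invr_ge0// invf_le1// ler1n.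
  apply: le_lt_trans hk; rewrite mulrDr mulr1.
  apply: (@le_trans _ _ ((2^-1 ^+ k + 2^-1 ^+ k) * vol K)); last first.
    by rewrite mulrDr mulrDl lerDl.
  apply: le_bochner_dist (is_bochner_simple sm) (is_bochner_simple sn) _ _ zm zn.
    by rewrite addr_ge0.
  move=> x _; apply: le_trans (nrm_distD _ (f x) _) _; rewrite lerD//.
    by rewrite nrmB; exact: le_trans (dm x) (le_k _ km).
  exact: le_trans (dn x) (le_k _ kn).
have cs x : simple_fct (s n) x @[n --> \oo] --> f x.
  apply/cvg_nrmP => e e0; have [k hk] := exists_half_lt e0; exists k => // n /= kn.
  have [_ _ dn] := hs n; rewrite nrmB; apply: le_lt_trans (dn x) _.
  by apply: le_lt_trans hk; apply: ler_wiXn2l => //; rewrite ?invr_ge0// invf_le1// ler1n.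
have si n : simple_integrable nu (s n) by have [] := hs n.
exists I, s; split=> //.
have mf : strongly_measurable (f : borel G -> E).
  by exists s; split=> // n; exact: simple_steps (si n).
have h : ((2^-1 ^+ n)%:E * nu K)%E @[n --> \oo] --> 0%E.
  rewrite -(mul0e (nu K)) -(fineK (_ : nu K \is a fin_num)) ?ge0_fin_numE//.
  apply: cvgeZr => //; apply: cvg_EFin; first exact: nearW.
  by apply: cvg_expr; rewrite ger0_norm ?invr_ge0// invf_lt1// ltr1n.
apply: (squeeze_cvge _ (cvg_cst _) h); apply: nearW => n.
rewrite integral_ge0/=; last by move=> x _; rewrite lee_fin nrm_ge0.
rewrite -integral_cst// [leRHS]integral_mkcond; have [_ zn dn] := hs n.
apply: ge0_le_integral => //.
- by move=> x _; rewrite lee_fin nrm_ge0.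
- apply: measurable_EFin_nrm; apply: strongly_measurableB => //.
  exact/strongly_measurable_simple/simple_steps/si.
- by apply/(measurable_restrictT _ mK); exact: measurable_cst.
move=> x _; rewrite patchE; case: ifPn => [_|/negP xK]; rewrite lee_fin//.
have Kx : ~ K x by move=> /mem_set.
by rewrite f0// zn// subrr nrm0.
Qed.

Lemma is_bochner_compact {E : normedModType R[i]} (f : G -> E) :
  seq_complete E -> continuous f -> (forall x, ~ K x -> f x = 0) ->
  is_bochner_integral nu f (bochner_integral nu f).
Proof.
move=> Ec cf f0; have [I hI] := bochner_compact_exists Ec cf f0.
by rewrite (bochner_integralE hI).
Qed.

End compact_support.

Let mulg_cont (g : G) : continuous (fun x : G => (g * x)%g).
Proof.
move=> x; apply: (@continuous_comp _ _ _ (fun x : G => (g, x))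
  (fun z : G * G => (z.1 * z.2)%g)).
  by apply: cvg_pair => //=; exact: cvg_cst.
exact: mulg_continuous.
Qed.

(** The preimage of A under translation by g is the translate of A by the inverse of g. *)
Lemma haar_preimage (g : G) (A : set (borel G)) : measurable A ->
  nu [set x | A (g * x)%g] = nu A.
Proof.
move=> mA; rewrite -(haar_left_invariant haar g^-1%g mA); congr (nu _).
apply/seteqP; split=> x /=; first by move=> Ax; exists (g * x)%g => //; rewrite mulKg.
by move=> [y Ay <-]; rewrite mulVKg.
Qed.

(** Translating the sets of the approximating steps leaves their integrals unchanged, and also the
    integrals of the errors, because the pushforward of nu under translation is nu. *)
Lemma is_bochner_translate {E : normedModType R[i]} (f : G -> E) I (g : G) :
  is_bochner_integral nu f I -> is_bochner_integral nu (fun x => f (g * x)%g) I.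
Proof.
move=> hf; have mf := is_bochner_measurable hf.
have mg : measurable_fun setT ((fun x => (g * x)%g) : borel G -> borel G).
  exact: (@borel_continuous G _ (@mulg_cont g)).
pose tr (s : seq (set (borel G) * E)) : seq (set (borel G) * E) :=
  [seq ([set x | Ae.1 (g * x)%g], Ae.2) | Ae <- s].
have mtr A : measurable (A : set (borel G)) ->
    measurable ([set x | A (g * x)%g] : set (borel G)).
  by move=> mA; rewrite -[X in measurable X]setTI; exact: mg.
have trE s x : simple_fct (tr s) x = simple_fct s (g * x)%g.
  by rewrite /simple_fct big_map; apply: eq_bigr => Ae _ /=; rewrite !indicE.
move: hf => [s [si sf s0 sI]]; exists (tr \o s); split=> [n _ /mapP[Ae As ->] /=|x||].
- by have [mA fA] := si n _ As; split; [exact: mtr|rewrite haar_preimage].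
- by under eq_fun do rewrite /= trE; exact: sf.
- rewrite (_ : (fun n => _) = fun n => (\int[nu]_x (nrm (f x - simple_fct (s n) x))%:E)%E)//.
  apply/funext => n.
  under eq_integral do rewrite /= trE.
  have mfs : measurable_fun setT (fun x : borel G => (nrm (f x - simple_fct (s n) x))%:E).
    apply: measurable_EFin_nrm; apply: strongly_measurableB => //.
    exact/strongly_measurable_simple/simple_steps/si.
  have := @ge0_integral_pushforward _ _ _ _ R _ mg nu setT _ measurableT mfs.
  rewrite preimage_setT => <-; last by move=> x _; rewrite lee_fin nrm_ge0.
  by apply: eq_measure_integral => A mA _; rewrite /pushforward; exact: haar_preimage.
- rewrite (_ : (fun n => _) = fun n => simple_int nu (s n))//.
  apply/funext => n; rewrite /simple_int big_map; apply: eq_big_seq => Ae As /=.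
  by have [mA _] := si n _ As; rewrite haar_preimage.
Qed.

(** * Integrals depending on a parameter *)

Section parameters.
Context {T : topologicalType} {E : normedModType R[i]}.
Variables (F : T -> G -> E) (K : set G).
Hypothesis cF : continuous (fun z : T * G => F z.1 z.2).
Hypothesis cK : compact K.

Lemma continuous_param (t : T) : continuous (F t).
Proof.
move=> x; apply: (@continuous_comp _ _ _ (fun x : G => (t, x)) (fun z : T * G => F z.1 z.2)).
  by apply: cvg_pair => //=; exact: cvg_cst.
exact: cF.
Qed.

(** The tube lemma: joint continuity gives a product neighbourhood of (t, x) for each x in K, and
    compactness of K leaves a single neighbourhood of t. *)
Lemma near_compact_uniform (t : T) (e : R) : 0 < e ->
  \forall t' \near t, forall x, K x -> nrm (F t' x - F t x) < e.
Proof.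
move=> e0; have e2 : 0 < e / 2 by rewrite divr_gt0.
move/compact_near_coveringP : (cK).
apply => x Kx.
have /cvg_nrmP/(_ _ e2) h1 := @cF (t, x).
have /cvg_nrmP/(_ _ e2) h2 := @continuous_param t x.
have [[U V] [/= tU xV] UV] := h1.
exists (V `&` [set x' | nrm (F t x' - F t x) < e / 2], U).
  by split=> //; exact: filterI.
move=> [x' t'] [[Vx' x'2] Ut'] /=; rewrite (splitr e).
apply: le_lt_trans (nrm_distD _ (F t x) _) _; apply: ltrD; last by rewrite nrmB.
exact: (UV (t', x')).
Qed.

Hypothesis F0 : forall t x, ~ K x -> F t x = 0.
Hypothesis Ec : seq_complete E.

Lemma is_bochner_param (t : T) :
  is_bochner_integral nu (F t) (bochner_integral nu (F t)).
Proof.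
apply: (is_bochner_compact cK Ec); [exact: continuous_param|exact: F0].
Qed.

Lemma continuous_bochner_param : continuous (fun t => bochner_integral nu (F t)).
Proof.
move=> t; apply/cvg_nrmP => e e0.
have k0 : 0 < vol K + 1 by rewrite ltr_wpDl.
have h := near_compact_uniform t (divr_gt0 e0 k0).
apply: filterS h => t' h.
have ek0 : 0 < e / (vol K + 1) by rewrite divr_gt0.
apply: (@le_lt_trans _ _ (e / (vol K + 1) * vol K)).
  apply: (le_bochner_dist cK (is_bochner_param t') (is_bochner_param t)) => //.
  - exact: ltW.
  - by move=> x Kx; exact/ltW/h.
  - exact: F0.
  - exact: F0.
by rewrite mulrAC ltr_pdivrMr// ltr_pM2l// ltrDl.
Qed.

End parameters.

(** * Exchange of two integrals *)

Section fubini.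
Context {E : normedModType R[i]}.
Hypothesis Ec : seq_complete E.
Variables (F : G -> G -> E) (K L : set G).
Hypothesis cF : continuous (fun z : G * G => F z.1 z.2).
Hypothesis cK : compact K.
Hypothesis cL : compact L.
Hypothesis FK : forall x y, ~ K x -> F x y = 0.
Hypothesis FL : forall x y, ~ L y -> F x y = 0.

Let cF' : continuous (fun z : G * G => F z.2 z.1).
Proof.
move=> z; apply: (@continuous_comp _ _ _ (fun z : G * G => (z.2, z.1)) (fun z => F z.1 z.2)).
  by apply: cvg_pair; [exact: cvg_snd|exact: cvg_fst].
exact: cF.
Qed.

Let is_bochner_sum (s : seq (set (borel G) * G)) :
  is_bochner_integral nu (fun y => simple_int nu (map_steps (F ^~ y) s))
    (simple_int nu (map_steps (fun x => bochner_integral nu (F x)) s)).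
Proof.
elim: s => [|[A x] s IH].
  rewrite [X in is_bochner_integral _ X](_ : _ = fun=> 0).
    by rewrite /simple_int big_nil; exact: is_bochner0.
  by apply/funext => y; rewrite /simple_int big_nil.
rewrite [X in is_bochner_integral _ X](_ : _ =
  fun y => (fine (nu A))%:C *: F x y + simple_int nu (map_steps (F^~ y) s)); last first.
  by apply/funext => y; rewrite /simple_int big_cons.
rewrite [X in is_bochner_integral _ _ X]/simple_int big_cons.
by apply: is_bochner_comb IH; exact: (is_bochner_param cF cL FL Ec).
Qed.

Lemma bochner_fubini :
  bochner_integral nu (fun x => bochner_integral nu (F x)) =
  bochner_integral nu (fun y => bochner_integral nu (F ^~ y)).
Proof.
have hK x (e : R) : 0 < e -> nbhs x [set x' | forall y, L y -> nrm (F x' y - F x y) < e].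
  by move=> e0; exact: near_compact_uniform.
have FK' y x : ~ K x -> F x y = 0 by exact: FK.
have FL' y : ~ L y -> bochner_integral nu (F^~ y) = 0.
  move=> Ly; rewrite (_ : F^~ y = fun=> 0); last by apply/funext => x; exact: FL.
  exact/bochner_integralE/is_bochner0.
have FK0 x : ~ K x -> bochner_integral nu (F x) = 0.
  move=> Kx; rewrite (_ : F x = fun=> 0); last by apply/funext => y; exact: FK.
  exact/bochner_integralE/is_bochner0.
have h1 := is_bochner_compact cK Ec (@continuous_bochner_param _ _ _ _ cF cL FL Ec) FK0.
have h2 := is_bochner_compact cL Ec (@continuous_bochner_param _ _ _ _ cF' cK FK' Ec) FL'.
set J1 := bochner_integral nu _ in h1 *; set J2 := bochner_integral nu _ in h2 *.
apply/eqP; rewrite -subr_eq0; apply/eqP/nrm0_eq0/le_anti; rewrite nrm_ge0 andbT.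
(* Each of the two comparisons with S costs e times the product of the two volumes. *)
pose M := vol L * vol K + vol K * vol L.
have M0 : 0 <= M by rewrite addr_ge0// mulr_ge0.
suff h (e : R) : 0 < e -> nrm (J1 - J2) <= e * M.
  apply/ler_addgt0Pl => e e0; rewrite addr0.
  have k0 : 0 < M + 1 by rewrite ltr_wpDl.
  apply: le_trans (h _ (divr_gt0 e0 k0)) _.
  by rewrite mulrAC ler_pdivrMr// ler_pM2l// lerDl.
(* Both iterated integrals are compared with that of the sum over i of
   1_(A_i)(x) F(x_i, y), whose value is S. *)
move=> e0; have [s [s1 s2 s3]] := @compact_partition G R K _ (borel_compact hG cK) cK
  (fun x _ => hK x e e0).
set S := simple_int nu (map_steps (fun x => bochner_integral nu (F x)) s).
have si (h : G -> E) : simple_integrable nu (map_steps h s).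
  by exact: (simple_integrable_sub cK).
apply: le_trans (nrm_distD _ S _) _; rewrite mulrDr; apply: lerD.
  rewrite mulrA; apply: (le_bochner_dist cK h1 (is_bochner_simple (si _))) => //.
  - by rewrite mulr_ge0// ltW.
  - move=> x /s3[x' xx' ->].
    apply: (le_bochner_dist cL (is_bochner_param cF cL FL Ec x)
      (is_bochner_param cF cL FL Ec x')).
    + exact: ltW.
    + by move=> y Ly; exact/ltW/xx'.
    + exact: FL.
    + exact: FL.
  - by move=> x Kx; exact: s2.
rewrite nrmB mulrA; apply: (le_bochner_dist cL h2 (is_bochner_sum s)) => //.
- by rewrite mulr_ge0// ltW.
- move=> y Ly; apply: (le_bochner_dist cK (is_bochner_param cF' cK FK' Ec y)
    (is_bochner_simple (si _))) => //; first exact: ltW.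
  + by move=> x /s3[x' xx' ->]; exact/ltW/xx'.
  + by move=> x; exact: FK.
  + by move=> x Kx; exact: s2.
- move=> y Ly; rewrite (_ : map_steps _ _ = map_steps (fun=> 0) s).
    by rewrite /simple_int big_map big1// => Ax _; rewrite /= scaler0.
  by apply: eq_map => Ax; rewrite FL.
Qed.

End fubini.
End compactly_supported_integrals.

(** * Convolution and integrated forms *)

Section joint_continuity.
Context {R : realType}.

(** B(f, g) - B(a, b) = B(f - a, g) + B(a, g - b). It serves for the product of an algebra and for
    the evaluation of pi(x) at y. *)
Lemma bilinear_cvg {E F H : normedModType R[i]} (B : E -> F -> H) :
  (forall y, linear (B ^~ y)) -> (forall x, linear (B x)) ->
  (forall x y, nrm (B x y) <= nrm x * nrm y) ->
  forall (T : Type) (Fi : set_system T) (FF : Filter Fi) (f : T -> E) (g : T -> F) a b,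
  f t @[t --> Fi] --> a -> g t @[t --> Fi] --> b -> B (f t) (g t) @[t --> Fi] --> B a b.
Proof.
move=> lB rB bB T Fi FF f g a b fa gb; apply/cvg_nrm0.
have h : nrm (f t - a) * nrm (g t) + nrm a * nrm (g t - b) @[t --> Fi] -->
    0 * nrm b + nrm a * 0.
  apply: cvgD; apply: cvgM; [exact: (proj1 (cvg_nrm0 f a))|exact: cvg_nrm|exact: cvg_cst|].
  exact: (proj1 (cvg_nrm0 g b)).
rewrite mul0r mulr0 addr0 in h.
apply: (squeeze_cvgr _ (cvg_cst (0 : R)) h); apply: nearW => t.
rewrite nrm_ge0/=; apply: le_trans (nrm_distD _ (B a (g t)) _) _; apply: lerD.
  by rewrite -(linearfB (lB (g t))) bB.
by rewrite -(linearfB (rB a)) bB.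
Qed.

(** Equicontinuity turns the strong continuity of alpha and of v into joint continuity. *)
Lemma lipschitz_family_cvg {I : topologicalType} {E F : normedModType R[i]} (S : I -> E -> F) :
  (forall i x y, nrm (S i x - S i y) <= nrm (x - y)) ->
  (forall x, continuous (S ^~ x)) ->
  forall (T : Type) (Fi : set_system T) (FF : Filter Fi) (h : T -> I) (w : T -> E) i x,
  h t @[t --> Fi] --> i -> w t @[t --> Fi] --> x -> S (h t) (w t) @[t --> Fi] --> S i x.
Proof.
move=> lS cS T Fi FF h w i x hi wx; apply/cvg_nrm0.
have k : nrm (w t - x) + nrm (S (h t) x - S i x) @[t --> Fi] --> (0 + 0 : R).
  apply: cvgD; first exact: (proj1 (cvg_nrm0 w x)).
  apply: (proj1 (cvg_nrm0 (fun t => S (h t) x) (S i x))).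
  exact: (cvg_comp _ _ hi (@cS x i)).
rewrite addr0 in k.
apply: (squeeze_cvgr _ (cvg_cst (0 : R)) k); apply: nearW => t.
rewrite nrm_ge0/=; apply: le_trans (nrm_distD _ (S (h t) x) _) _.
by rewrite lerD2r lS.
Qed.

Lemma nrm_nmul {A : normedAlgType R[i]} (a b : A) : nrm (nmul a b) <= nrm a * nrm b.
Proof. by rewrite -lecR rmorphM/= -!nrmE ler_normM. Qed.

Lemma linear_nmull {A : normedAlgType R[i]} (b : A) : linear (fun a : A => nmul a b).
Proof. by move=> k x y; rewrite nmulDl nmulZl. Qed.

Lemma linear_nmulr {A : normedAlgType R[i]} (a : A) : linear (nmul a).
Proof. by move=> k x y; rewrite nmulDr nmulZr. Qed.

Lemma continuous_nmul {A : normedAlgType R[i]} {T : topologicalType} (f g : T -> A) :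
  continuous f -> continuous g -> continuous (fun t => nmul (f t) (g t)).
Proof.
move=> cf cg t; apply: (bilinear_cvg linear_nmull linear_nmulr nrm_nmul); [exact: cf|exact: cg].
Qed.

Lemma continuous_mulg {G : topologicalGroupType} {T : topologicalType} (f g : T -> G) :
  continuous f -> continuous g -> continuous (fun t => f t * g t)%g.
Proof.
move=> cf cg t; apply: (@continuous_comp _ _ _ (fun t => (f t, g t))
  (fun z : G * G => (z.1 * z.2)%g)).
  by apply: cvg_pair; [exact: cf|exact: cg].
exact: mulg_continuous.
Qed.

Lemma continuous_invg {G : topologicalGroupType} {T : topologicalType} (f : T -> G) :
  continuous f -> continuous (fun t => (f t)^-1)%g.
Proof.
by move=> cf t; apply: (@continuous_comp _ _ _ f); [exact: cf|exact: invg_continuous].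
Qed.

Lemma continuous_compose {S T U : topologicalType} (f : S -> T) (g : T -> U) :
  continuous f -> continuous g -> continuous (fun t => g (f t)).
Proof. by move=> cf cg t; apply: continuous_comp; [exact: cf|exact: cg]. Qed.

Lemma continuous_fst {S T : topologicalType} : continuous (fun z : S * T => z.1).
Proof. by move=> z; exact: cvg_fst. Qed.

Lemma continuous_snd {S T : topologicalType} : continuous (fun z : S * T => z.2).
Proof. by move=> z; exact: cvg_snd. Qed.

End joint_continuity.

Section Cc_functions.
Context {R : realType} {G : topologicalGroupType} {E : normedModType R[i]}.
Implicit Types a : Cc G E.

Definition supp a : set G := closure [set g | a g != 0].

Lemma Cc_continuous a : continuous a.
Proof. by have := Cc_subproof a; rewrite inE => -[]. Qed.

Lemma supp_compact a : compact (supp a).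
Proof. by have := Cc_subproof a; rewrite inE => -[]. Qed.

Lemma supp_out a g : ~ supp a g -> a g = 0.
Proof.
by move=> ag; apply/eqP; apply: contrapT => /negP ag0; apply: ag; exact: subset_closure.
Qed.

Lemma Cc_bounded a : exists2 c : R, 0 <= c & forall g, nrm (a g) <= c.
Proof.
have ca : continuous (fun g => nrm (a g) : R).
  by move=> g; apply: cvg_nrm; exact: Cc_continuous.
have /compact_bounded[M [_ hM]] :=
  continuous_compact (continuous_subspaceT ca) (supp_compact (a:=a)).
exists (`|M| + 1) => [|g]; first by rewrite addr_ge0.
have [ga|/supp_out ->] := pselect (supp a g); last by rewrite nrm0 addr_ge0.
have := hM (`|M| + 1); rewrite (le_lt_trans (ler_norm M)) ?ltrDl// => /(_ isT) /=.
by move=> /(_ (nrm (a g))); rewrite ger0_norm ?nrm_ge0//; apply; exists g.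
Qed.

Definition mulset (K L : set G) : set G :=
  (fun z : G * G => (z.1 * z.2)%g) @` (K `*` L).

Lemma compact_mulset (K L : set G) : compact K -> compact L -> compact (mulset K L).
Proof.
move=> cK cL; apply: continuous_compact; last exact: compact_setX.
by apply: continuous_subspaceT; exact: mulg_continuous.
Qed.

Lemma mulset_out (K L : set G) g h : ~ mulset K L g -> ~ K h \/ ~ L (h^-1 * g)%g.
Proof.
move=> gKL; apply: contrapT => /not_orP[/contrapT Kh /contrapT Lh]; apply: gKL.
by exists (h, h^-1 * g)%g => //=; rewrite mulVKg.
Qed.

End Cc_functions.

(** * The convolution algebra *)

Section convolution_algebra.
Context {R : realType} {G : topologicalGroupType}.
Hypothesis hG : hausdorff_space G.
Variable nu : {measure set (borel G) -> \bar R}.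
Hypothesis haar : left_haar nu.
Context {A : banachAlgType R[i]}.
Variable alpha : G -> A -> A.
Hypothesis action : isometric_action alpha.
Implicit Types a b c : Cc G A.

Let Ac : seq_complete A := @banach_seq_complete R A.

Lemma linear_action g : linear (alpha g).
Proof. by have [] := action_hom action g. Qed.

Lemma action_mul g x y : alpha g (nmul x y) = nmul (alpha g x) (alpha g y).
Proof. by have [_] := action_hom action g; apply. Qed.

Lemma nrm_action g x : nrm (alpha g x) = nrm x.
Proof. by rewrite /nrm (action_isometric action). Qed.

Lemma continuous_action {T : topologicalType} (h : T -> G) (f : T -> A) :
  continuous h -> continuous f -> continuous (fun t => alpha (h t) (f t)).
Proof.
move=> ch cf t; apply: (lipschitz_family_cvg (S := alpha)); [| |exact: ch|exact: cf].
  by move=> g x y; rewrite -(linearfB (linear_action g)) nrm_action.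
exact: action_continuous action.
Qed.

Definition conv_integrand a b (g h : G) : A := nmul (a h) (alpha h (b (h^-1 * g)%g)).

Lemma continuous_conv_integrand {T : topologicalType} a b (u w : T -> G) :
  continuous u -> continuous w -> continuous (fun t => conv_integrand a b (u t) (w t)).
Proof.
move=> cu cw; apply: continuous_nmul.
  by apply: continuous_compose cw _; exact: Cc_continuous.
apply: continuous_action => //; apply: continuous_compose; last exact: Cc_continuous.
by apply: continuous_mulg => //; exact: continuous_invg.
Qed.

Lemma conv_integrand_out a b g h : ~ supp a h -> conv_integrand a b g h = 0.
Proof. by move=> /supp_out ah; rewrite /conv_integrand ah (linearf0 (linear_nmull _)). Qed.

Lemma conv_integrand_outr a b g h : ~ supp b (h^-1 * g)%g -> conv_integrand a b g h = 0.
Proof.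
move=> /supp_out bh; rewrite /conv_integrand bh (linearf0 (linear_action _)).
exact: (linearf0 (linear_nmulr _)).
Qed.

Lemma is_bochner_convolution a b g :
  is_bochner_integral nu (conv_integrand a b g) (convolution nu alpha a b g).
Proof.
apply: (is_bochner_param hG haar (F := conv_integrand a b) _ (supp_compact (a:=a))) => //.
  by apply: continuous_conv_integrand; [exact: continuous_fst|exact: continuous_snd].
by move=> t x; exact: conv_integrand_out.
Qed.

Lemma convolution_continuous a b : continuous (convolution nu alpha a b).
Proof.
apply: (continuous_bochner_param hG haar (F := conv_integrand a b) _ (supp_compact (a:=a))) => //.
  by apply: continuous_conv_integrand; [exact: continuous_fst|exact: continuous_snd].
by move=> t x; exact: conv_integrand_out.
Qed.

Lemma convolution_out a b g : ~ mulset (supp a) (supp b) g -> convolution nu alpha a b g = 0.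
Proof.
move=> gab; apply: bochner_integralE; rewrite [X in is_bochner_integral _ X](_ : _ = fun=> 0).
  exact: is_bochner0.
apply/funext => h; have [ah|bh] := mulset_out h gab; first exact: conv_integrand_out.
exact: conv_integrand_outr.
Qed.

Lemma convolution_in_Cc a b : convolution nu alpha a b \in Cc_pred G A.
Proof.
rewrite inE; split; first exact: convolution_continuous.
have cab := compact_mulset (supp_compact (a:=a)) (supp_compact (a:=b)).
apply: (subclosed_compact _ cab); first exact: closed_closure.
rewrite [X in _ `<=` X](closure_id _).1; last exact: compact_closed.
apply: closureS => g /= gab; apply: contrapT => /convolution_out ab0.
by move: gab; rewrite ab0 eqxx.
Qed.

Let mul := Cc_mul convolution_in_Cc.

Let ext a b : (forall g, a g = b g) -> a = b.
Proof. by move=> ab; apply/val_inj/funext. Qed.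

Lemma convolutionDl a b c (k : R[i]) : mul (k *: a + b) c = k *: mul a c + mul b c.
Proof.
apply: ext => g; apply: bochner_integralE.
have := is_bochner_comb k (is_bochner_convolution a c g) (is_bochner_convolution b c g).
congr (is_bochner_integral _ _ _); apply/funext => h.
by rewrite /conv_integrand -linear_nmull.
Qed.

Lemma convolutionDr a b c (k : R[i]) : mul a (k *: b + c) = k *: mul a b + mul a c.
Proof.
apply: ext => g; apply: bochner_integralE.
have := is_bochner_comb k (is_bochner_convolution a b g) (is_bochner_convolution a c g).
congr (is_bochner_integral _ _ _); apply/funext => h.
by rewrite /conv_integrand -linear_nmulr -linear_action.
Qed.

(** Integrating F(k, h) = a(h) alpha_h(b(h^-1 k)) alpha_k(c(k^-1 g)) over h and then k gives
    ((ab)c)(g). In the other order, the translation of k by h^-1 turns the inner integral into a(h)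
    alpha_h((bc)(h^-1 g)). *)
Lemma convolutionA : associative mul.
Proof.
move=> a b c; apply: ext => g; apply/esym.
pose F (k h : G) := nmul (conv_integrand a b k h) (alpha k (c (k^-1 * g)%g)).
have cF : continuous (fun z : G * G => F z.1 z.2).
  apply: continuous_nmul.
    by apply: continuous_conv_integrand; [exact: continuous_fst|exact: continuous_snd].
  apply: continuous_action; first exact: continuous_fst.
  apply: continuous_compose; last exact: Cc_continuous.
  apply: continuous_mulg; last exact: cst_continuous.
  by apply: continuous_invg; exact: continuous_fst.
have cab := compact_mulset (supp_compact (a:=a)) (supp_compact (a:=b)).
have F0l k h : ~ mulset (supp a) (supp b) k -> F k h = 0.
  move=> kab; rewrite /F; have [ah|bh] := mulset_out h kab.
    by rewrite conv_integrand_out// (linearf0 (linear_nmull _)).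
  by rewrite conv_integrand_outr// (linearf0 (linear_nmull _)).
have F0r k h : ~ supp a h -> F k h = 0.
  by move=> ah; rewrite /F conv_integrand_out// (linearf0 (linear_nmull _)).
have fub := bochner_fubini hG haar Ac cF cab (supp_compact (a:=a)) F0l F0r.
transitivity (bochner_integral nu (fun k => bochner_integral nu (F k))).
  congr (bochner_integral _ _); apply/funext => k; apply/esym/bochner_integralE.
  apply: (is_bochner_map (M := nrm (alpha k (c (k^-1 * g)%g))) (linear_nmull _)).
    by move=> x; rewrite mulrC nrm_nmul.
  exact: is_bochner_convolution.
rewrite fub; congr (bochner_integral _ _); apply/funext => h; apply: bochner_integralE.
have := is_bochner_translate haar h^-1%g (is_bochner_convolution b c (h^-1 * g)%g).
move/(is_bochner_map (h := fun x => nmul (a h) (alpha h x)) (M := nrm (a h))).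
have lin : linear (fun x => nmul (a h) (alpha h x)).
  by move=> k x y; rewrite (linear_action h) linear_nmulr.
move/(_ lin); have bnd x : nrm (nmul (a h) (alpha h x)) <= nrm (a h) * nrm x.
  by rewrite -(nrm_action h x) nrm_nmul.
move/(_ bnd); congr (is_bochner_integral _ _ _); apply/funext => k.
rewrite /F /conv_integrand action_mul nmulA -(actionM action) mulVKg.
by rewrite invgM invgK -mulgA mulVKg.
Qed.

(** * Integrated forms of covariant representations *)

Section integrated_forms.
Context {E : normedModType R[i]}.
Hypothesis Ec : seq_complete E.
Variables (v : G -> bop E) (pi : A -> bop E).
Hypothesis cov : contractive_covariant alpha v pi.

Let cvp : covariant_representation alpha v pi. Proof. by case: cov. Qed.

Let pi_linear : linear pi. Proof. by have [[]] := cov_pi cvp. Qed.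

Let pi_mul x y : pi (nmul x y) = nmul (pi x) (pi y).
Proof. by have [[_ h] _] := cov_pi cvp; exact: h. Qed.

Let nrm_pi x (y : E) : nrm (pi x y) <= nrm x * nrm y.
Proof.
apply: le_trans (le_opnorm _ _) _; rewrite ler_wpM2r ?nrm_ge0// -nrm_bop.
by have [_ _ /(_ x)] := cov; rewrite !nrmE lecR.
Qed.

Let nrm_v g (y : E) : nrm (v g y) <= nrm y.
Proof.
apply: le_trans (le_opnorm _ _) _; rewrite ler_piMl ?nrm_ge0// -nrm_bop.
by have [_ /(_ g) + _] := cov; rewrite nrmE (_ : 1 = 1%:C :> R[i])// lecR.
Qed.

Let linear_pil (y : E) : linear (fun x => pi x y).
Proof. by move=> k x x'; rewrite pi_linear. Qed.

Let continuous_pi {T : topologicalType} (f : T -> A) (w : T -> E) :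
  continuous f -> continuous w -> continuous (fun t => pi (f t) (w t)).
Proof.
move=> cf cw t.
apply: (bilinear_cvg linear_pil (fun x => bop_linear (pi x)) nrm_pi); [exact: cf|exact: cw].
Qed.

Let continuous_v {T : topologicalType} (h : T -> G) (w : T -> E) :
  continuous h -> continuous w -> continuous (fun t => v (h t) (w t)).
Proof.
move=> ch cw t.
apply: (lipschitz_family_cvg (S := fun g => v g : E -> E)); [| |exact: ch|exact: cw].
  by move=> g x y; rewrite -(linearfB (bop_linear (v g))) nrm_v.
exact: cov_v_continuous cvp.
Qed.

Definition form_integrand a (x : E) (g : G) : E := pi (a g) (v g x).

Let form_integrand_out a x g : ~ supp a g -> form_integrand a x g = 0.
Proof. by move=> /supp_out ag; rewrite /form_integrand ag (linearf0 (linear_pil _)). Qed.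

Let form_integrand_continuous a x : continuous (form_integrand a x).
Proof.
apply: continuous_pi; first exact: Cc_continuous.
by apply: continuous_v; [move=> ?; exact: cvg_id|exact: cst_continuous].
Qed.

Lemma is_bochner_form a x :
  is_bochner_integral nu (form_integrand a x) (integrated_form nu v pi a x).
Proof.
apply: (is_bochner_compact hG haar (supp_compact (a:=a)) Ec).
  exact: form_integrand_continuous.
exact: form_integrand_out.
Qed.

(** The constant depends on a alone, not on E, v or pi, which is what bounds the supremum over all
    representations. *)
Lemma integrated_form_le a (c : R) x : 0 <= c -> (forall g, nrm (a g) <= c) ->
  nrm (integrated_form nu v pi a x) <= c * fine (nu (supp a)) * nrm x.
Proof.
move=> c0 ac; rewrite mulrAC.
apply: (le_bochner_compact hG haar (supp_compact (a:=a)) (is_bochner_form a x)).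
- by rewrite mulr_ge0// nrm_ge0.
- move=> g _; apply: le_trans (nrm_pi _ _) _.
  by apply: ler_pM => //; exact: nrm_ge0.
- exact: form_integrand_out.
Qed.

Lemma integrated_form_bounded a :
  integrated_form nu v pi a \in @bounded_linear_pred R E.
Proof.
rewrite inE; split=> [k x y|]; last first.
  have [c c0 ac] := Cc_bounded a; exists (c * fine (nu (supp a))) => x.
  exact: integrated_form_le.
apply: bochner_integralE; have := is_bochner_comb k (is_bochner_form a x) (is_bochner_form a y).
by congr (is_bochner_integral _ _ _); apply/funext => g; rewrite /form_integrand !bop_linear.
Qed.

Definition form_op a : bop E := Bop (integrated_form_bounded a).

Lemma form_op_linear : linear form_op.
Proof.
move=> k a b; apply/val_inj/funext => x; apply: bochner_integralE.
have := is_bochner_comb k (is_bochner_form a x) (is_bochner_form b x).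
by congr (is_bochner_integral _ _ _); apply/funext => g; rewrite /form_integrand -linear_pil.
Qed.

(** As for associativity, with v_g x in place of alpha_k(c(k^-1 g)). Covariance gives pi(alpha_h(y))
    v_g = v_h pi(y) v_(h^-1 g), so that after translating g by h^-1 the operator pi(a(h)) v_h leaves
    the inner integral. *)
Lemma form_op_mul a b : form_op (mul a b) = nmul (form_op a) (form_op b).
Proof.
apply/val_inj/funext => x; rewrite /= /integrated_form.
pose F (g h : G) : E := pi (conv_integrand a b g h) (v g x).
have cF : continuous (fun z : G * G => F z.1 z.2).
  apply: continuous_pi.
    by apply: continuous_conv_integrand; [exact: continuous_fst|exact: continuous_snd].
  by apply: continuous_v; [exact: continuous_fst|exact: cst_continuous].
have cab := compact_mulset (supp_compact (a:=a)) (supp_compact (a:=b)).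
have F0l g h : ~ mulset (supp a) (supp b) g -> F g h = 0.
  move=> gab; rewrite /F; have [ah|bh] := mulset_out h gab.
    by rewrite conv_integrand_out// (linearf0 (linear_pil _)).
  by rewrite conv_integrand_outr// (linearf0 (linear_pil _)).
have F0r g h : ~ supp a h -> F g h = 0.
  by move=> ah; rewrite /F conv_integrand_out// (linearf0 (linear_pil _)).
have fub := bochner_fubini hG haar Ec cF cab (supp_compact (a:=a)) F0l F0r.
transitivity (bochner_integral nu (fun g => bochner_integral nu (F g))).
  congr (bochner_integral _ _); apply/funext => g; apply/esym/bochner_integralE.
  apply: (is_bochner_map (M := nrm (v g x)) (linear_pil _)).
    by move=> y; rewrite mulrC nrm_pi.
  exact: is_bochner_convolution.
rewrite fub; congr (bochner_integral _ _); apply/funext => h; apply: bochner_integralE.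
have := is_bochner_translate haar h^-1%g (is_bochner_form b x).
move/(is_bochner_map (h := fun y => pi (a h) (v h y)) (M := nrm (a h))).
have lin : linear (fun y => pi (a h) (v h y)) by move=> k y z; rewrite !bop_linear.
move/(_ lin); have bnd y : nrm (pi (a h) (v h y)) <= nrm (a h) * nrm y.
  by apply: le_trans (nrm_pi _ _) _; rewrite ler_wpM2l ?nrm_ge0.
move/(_ bnd); congr (is_bochner_integral _ _ _); apply/funext => g.
rewrite /F /conv_integrand /form_integrand pi_mul /= (cov_covariant cvp).
by rewrite (cov_vM cvp).
Qed.

End integrated_forms.

End convolution_algebra.

(** * The full crossed product *)

Section zero_representation.
Context {R : realType}.

Lemma bop_id_subproof (E : normedModType R[i]) :
  (id : E -> E) \in @bounded_linear_pred R E.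
Proof. by rewrite inE; split=> //; exists 1 => x; rewrite mul1r. Qed.

Definition bop_id (E : normedModType R[i]) : bop E := Bop (bop_id_subproof E).

Variables (p : R) (p1 : 1 <= p) (d : measure_display) (X : measurableType d).
Local Notation E := (Lp (@mzero d X R) p1).

Lemma Lp_mzero_trivial (x : E) : x = 0.
Proof.
apply: nrm0_eq0; rewrite -(sep_piK x) nrm_sep_pi; apply/Lp_fun_norm_eq0.
by exists setT.
Qed.

Lemma zero_representation (G : topologicalGroupType) (A : banachAlgType R[i])
    (alpha : G -> A -> A) :
  [/\ sigma_finite setT (@mzero d X R),
      contractive_covariant alpha (fun _ : G => bop_id E) (fun _ : A => 0 : bop E)
    & nondegenerate_rep (fun _ : A => 0 : bop E)].
Proof.
have triv (x y : E) : x = y.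
  by rewrite (Lp_mzero_trivial x) (Lp_mzero_trivial y).
have trivb (S T : bop E) : S = T by apply/val_inj/funext.
split.
- exists (fun=> setT); first by rewrite bigcup_const//; exists 0%N.
  by move=> i; split=> //; exact: ltry.
- split=> [|g|a]; last by rewrite normr0.
    split=> // [x|]; first exact: cst_continuous.
    split; last exact: cst_continuous.
    by split=> [k x y|x y]; exact: trivb.
  rewrite nrmE (_ : 1 = 1%:C :> R[i])// lecR nrm_bop.
  by apply: opnorm_le => // x; rewrite mul1r.
move=> O [x Ox] _; exists 0; split; first by rewrite (triv 0 x).
by exists 0%N, (fun=> 0), (fun=> 0); split; [case|rewrite big_ord0].
Qed.

End zero_representation.

(** * Extension of contractive homomorphisms to the completion *)

Section operator_completeness.
Context {R : realType}.

(** The limit T is taken pointwise. Letting m tend to infinity in |u_n x - u_m x| <= e |x| gives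
    [near_T], from which both the boundedness of T and the convergence in operator norm follow. *)
Lemma bop_seq_complete (E : normedModType R[i]) : seq_complete E -> seq_complete (bop E).
Proof.
move=> Ec u cu.
have /choice[T hT] x : exists y : E, u n x @[n --> \oo] --> y.
  apply: Ec => e e0; have k0 : 0 < nrm x + 1 by rewrite ltr_wpDl// nrm_ge0.
  have [n0 h] := cu _ (divr_gt0 e0 k0); exists n0 => m n mn nn.
  apply: (@le_lt_trans _ _ (nrm (u m - u n) * nrm x)); first exact: (le_opnorm (u m - u n) x).
  apply: (@le_lt_trans _ _ (nrm (u m - u n) * (nrm x + 1))).
    by rewrite ler_wpM2l ?nrm_ge0// lerDl.
  by rewrite -ltr_pdivlMr// h.
have lT : linear T.
  move=> k x y; apply: (cvg_to_nrm (hT (k *: x + y))).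
  under eq_fun do rewrite bop_linear.
  by apply: cvgD; [apply: cvgZr; exact: hT|exact: hT].
have near_T e : 0 < e -> exists n0, forall n, (n0 <= n)%N -> forall x,
    nrm (u n x - T x) <= e * nrm x.
  move=> e0; have [n0 h] := cu _ e0; exists n0 => n nn x.
  have k : nrm (u n x - u m x) @[m --> \oo] --> nrm (u n x - T x).
    by apply: cvg_nrm; apply: cvgB; [exact: cvg_cst|exact: hT].
  apply: (cvgr_to_le k); exists n0 => // m /= nm.
  apply: le_trans (le_opnorm (u n - u m) x) _; rewrite ler_wpM2r ?nrm_ge0//.
  exact/ltW/h.
have bT : T \in @bounded_linear_pred R E.
  rewrite inE; split=> //; have [n0 h] := near_T 1 ltr01.
  exists (1 + opnorm (u n0)) => x; rewrite mulrDl.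
  rewrite -[T x](subrK (u n0 x)); apply: le_trans (ler_nrmD _ _) _; apply: lerD.
    by rewrite nrmB h.
  exact: le_opnorm.
exists (Bop bT); apply/cvg_nrmP => e e0; have e2 : 0 < e / 2 by rewrite divr_gt0.
have [n0 h] := near_T _ e2; exists n0 => // n /= nn.
apply: (@le_lt_trans _ _ (e / 2)); last by rewrite ltr_pdivrMr// ltr_pMr// ltr1n.
by rewrite nrm_bop; apply: opnorm_le => [|x]; [exact: ltW|exact: h].
Qed.

End operator_completeness.

Section completion_extension.
Context {R : realType} {V : lmodType R[i]}.
Variables (mul : V -> V -> V) (N : V -> R) (H : is_algebra_seminorm mul N).
Let HN := alg_seminorm H.

Lemma alg_completion_lift (B : normedAlgType R[i]) (Phi : V -> B) :
  seq_complete B -> linear Phi -> (forall a b, Phi (mul a b) = nmul (Phi a) (Phi b)) ->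
  (forall a, nrm (Phi a) <= N a) ->
  exists rho : alg_completion H -> B,
    [/\ algebra_hom rho, forall x, nrm (rho x) <= nrm x
      & forall a, rho (to_completion HN a) = Phi a].
Proof.
move=> Bc lPhi mPhi nPhi.
have PhiB := linearfB lPhi.
pose pi (u : cauchy_seq HN) : alg_completion H := sep_pi (cauchy_seminorm HN) u.
have cPhi (u : cauchy_seq HN) : exists y : B, Phi (u n) @[n --> \oo] --> y.
  apply: Bc => e e0; have [n0 h] := cauchy_seqP u e0; exists n0 => m n mn nn.
  by rewrite -PhiB; apply: le_lt_trans (nPhi _) _; exact: h.
have /choice[rho hrho] (x : alg_completion H) :
    exists y : B, Phi ((repr x : cauchy_seq HN) n) @[n --> \oo] --> y.
  exact: cPhi.
(* [rho] is defined along the representative picked by [repr]; any other one gives the same limit,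
   since the difference of the two tends to 0 in N. *)
have rho_pi (u : cauchy_seq HN) : Phi (u n) @[n --> \oo] --> rho (pi u).
  pose w : cauchy_seq HN := repr (pi u).
  have h0 : cauchy_norm (w - u) = 0 by exact: sep_reprK.
  have h1 := @cvg_cauchy_norm _ _ _ HN (w - u); rewrite h0 in h1.
  have h2 := proj1 (cvg_nrm0 (fun n => Phi (w n)) (rho (pi u))) (@hrho (pi u)).
  have h3 : N ((w - u) n) + nrm (Phi (w n) - rho (pi u)) @[n --> \oo] --> (0 + 0 : R).
    by apply: cvgD; [exact: h1|exact: h2].
  rewrite addr0 in h3.
  apply/cvg_nrm0; apply: (squeeze_cvgr _ (cvg_cst (0 : R)) h3).
  apply: nearW => n; rewrite nrm_ge0/=.
  apply: le_trans (nrm_distD _ (Phi (w n)) _) _.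
  by rewrite lerD2r nrmB -PhiB; exact: nPhi.
have piK x : pi (repr x) = x by exact: sep_piK.
have rho_comb k u w : rho (k *: pi u + pi w) = k *: rho (pi u) + rho (pi w).
  rewrite -sep_piZ -sep_piD; apply: (cvg_to_nrm (@rho_pi (k *: u + w))).
  rewrite (_ : (fun n => _) = fun n => k *: Phi (u n) + Phi (w n)); last first.
    by apply/funext => n; rewrite -lPhi.
  by apply: cvgD; [apply: cvgZr; exact: rho_pi|exact: rho_pi].
have rho_mul u w : rho (nmul (pi u) (pi w)) = nmul (rho (pi u)) (rho (pi w)).
  have -> : nmul (pi u) (pi w) = pi (cauchy_mul u w) by exact: completion_mul_pi.
  apply: (cvg_to_nrm (@rho_pi (cauchy_mul u w))).
  rewrite (_ : (fun n => _) = fun n => nmul (Phi (u n)) (Phi (w n))); last first.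
    by apply/funext => n; rewrite -mPhi.
  by apply: (bilinear_cvg linear_nmull linear_nmulr nrm_nmul); exact: rho_pi.
exists rho; split=> [|x|a].
- split=> [k x y|x y]; rewrite -(piK x) -(piK y); [exact: rho_comb|exact: rho_mul].
- rewrite -(piK x) nrm_sep_pi.
  have h1 : nrm (Phi ((repr x : cauchy_seq HN) n)) @[n --> \oo] --> nrm (rho (pi (repr x))).
    exact: (cvg_nrm (@rho_pi (repr x))).
  have h2 := @cvg_cauchy_norm _ _ _ HN (repr x : cauchy_seq HN).
  rewrite -subr_ge0; apply: (cvgr_to_ge (cvgB h2 h1)).
  by apply: nearW => n; rewrite subr_ge0; exact: nPhi.
apply: (cvg_to_nrm (@rho_pi (CauchySeq HN (cst_cauchy HN a)))).
exact: (@cvg_cst _ (Phi a)).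
Qed.

End completion_extension.

Section completion_maps.
Context {R : realType} {V : lmodType R[i]}.
Variables (N : V -> R) (HN : is_seminorm N).

Lemma to_completion_linear : linear (to_completion HN).
Proof.
move=> k x y; rewrite -sep_piZ -sep_piD; congr sep_pi.
exact/val_inj.
Qed.

Lemma nrm_to_completion x : nrm (to_completion HN x) = N x.
Proof.
by have := nrm_to_completionB HN x 0; rewrite -(linearfB to_completion_linear) subr0.
Qed.

End completion_maps.

(** * Norm, universal property and dense image of the crossed product *)

Section full_crossed_product.
Context {R : realType} (p : R) (p1 : 1 <= p) {G : topologicalGroupType}.
Hypothesis hG : hausdorff_space G.
Variable nu : {measure set (borel G) -> \bar R}.
Hypothesis haar : left_haar nu.
Context {A : banachAlgType R[i]}.
Variable alpha : G -> A -> A.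
Hypothesis action : isometric_action alpha.
Implicit Types a b : Cc G A.

Let N := full_norm nu alpha p1.

Let convK := convolution_in_Cc hG haar action.

Section one_representation.
Context (d : measure_display) (X : measurableType d) (mu : {measure set X -> \bar R}).
Variables (v : G -> bop (Lp mu p1)) (pi : A -> bop (Lp mu p1)).
Hypothesis cov : contractive_covariant alpha v pi.

(** The underlying function is [integrated_form], so its [opnorm] is the number collected in
    [full_norms]; as an element of [bop] it is subject to the algebra of operators. *)
Definition Lp_form a : bop (Lp mu p1) :=
  form_op hG haar (@Lp_seq_complete _ _ _ mu _ p1) cov a.

End one_representation.

Lemma full_norms_bounded a : has_sup (full_norms nu alpha p1 a).
Proof.
split.
  (* The zero measure needs some measurable space to live on; [borel G] is at hand. *)
  have [sf cov nd] := @zero_representation R p p1 _ (borel G) G A alpha.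
  by eexists; exists _, (borel G), mzero, (fun=> bop_id _), (fun=> 0); split.
have [c c0 ac] := Cc_bounded a; exists (c * fine (nu (supp a))).
move=> r [d [X [mu [v [pi [_ cov _ ->]]]]]]; apply: (@opnorm_le _ _ (Lp_form cov a)).
  by rewrite mulr_ge0// fine_ge0.
by move=> x; exact: (integrated_form_le hG haar (@Lp_seq_complete _ _ _ mu _ p1) cov).
Qed.

Lemma le_full_norm d (X : measurableType d) (mu : {measure set X -> \bar R})
    (v : G -> bop (Lp mu p1)) (pi : A -> bop (Lp mu p1))
    (cov : contractive_covariant alpha v pi) a :
  sigma_finite setT mu -> nondegenerate_rep pi -> opnorm (Lp_form cov a) <= N a.
Proof.
move=> sf nd; apply: ub_le_sup; first by have [] := full_norms_bounded a.
by exists d, X, mu, v, pi; split.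
Qed.

Lemma full_norm_le a M :
  (forall d (X : measurableType d) (mu : {measure set X -> \bar R})
    (v : G -> bop (Lp mu p1)) (pi : A -> bop (Lp mu p1))
    (cov : contractive_covariant alpha v pi),
    sigma_finite setT mu -> nondegenerate_rep pi -> opnorm (Lp_form cov a) <= M) ->
  N a <= M.
Proof.
move=> h; apply: ge_sup; first by have [] := full_norms_bounded a.
by move=> _ [d [X [mu [v [pi [sf cov nd ->]]]]]]; exact: (h d X mu v pi cov).
Qed.

Let N_ge0 a : 0 <= N a.
Proof.
have [sf cov nd] := @zero_representation R p p1 _ (borel G) G A alpha.
by apply: le_trans (le_full_norm cov a sf nd); exact: opnorm_ge0.
Qed.

Lemma full_norm_is_seminorm : is_seminorm N.
Proof.
have leZ (k : R[i]) a : N (k *: a) <= normc k * N a.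
  apply: full_norm_le => d X mu v pi cov sf nd.
  rewrite /Lp_form (linearfZ (form_op_linear hG haar _ cov)) opnormZ.
  rewrite ler_wpM2l ?normc_ge0//; exact: le_full_norm.
split=> [a b|k a].
  apply: full_norm_le => d X mu v pi cov sf nd.
  rewrite /Lp_form (linearfD (form_op_linear hG haar _ cov)).
  by apply: le_trans (opnormD _ _) _; apply: lerD; exact: le_full_norm.
apply/le_anti; rewrite leZ/=; have [->|k0] := eqVneq k 0.
  by rewrite normc0 mul0r.
have kp : 0 < normc k.
  by rewrite lt_def normc_ge0 andbT; apply: contra k0 => /eqP/eq0_normc ->.
(* The reverse inequality is [leZ] for the inverse scalar. *)
have := leZ k^-1 (k *: a); rewrite scalerA mulVf// scale1r normcV.
by rewrite mulrC ler_pdivlMr// mulrC.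
Qed.

Lemma full_norm_is_algebra_seminorm : is_algebra_seminorm (Cc_mul convK) N.
Proof.
have lin c : linear (fun a => Cc_mul convK a c).
  by move=> k a b; exact: (convolutionDl hG haar action).
have rin c : linear (Cc_mul convK c).
  by move=> k a b; exact: (convolutionDr hG haar action).
split.
- exact: full_norm_is_seminorm.
- exact: (convolutionA hG haar action).
- by move=> a b c; exact: (linearfD (lin c)).
- by move=> a b c; exact: (linearfD (rin a)).
- by move=> k a b; exact: (linearfZ (lin b)).
- by move=> k a b; exact: (linearfZ (rin a)).
move=> a b; apply: full_norm_le => d X mu v pi cov sf nd.
have -> : Lp_form cov (Cc_mul convK a b) = nmul (Lp_form cov a) (Lp_form cov b).
  exact: form_op_mul.
rewrite -nrm_bop; apply: le_trans (nrm_nmul _ _) _.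
by apply: ler_pM; rewrite ?nrm_ge0//; exact: le_full_norm.
Qed.

Definition full_crossed_product_exists : crossed_product_wf nu alpha p1 :=
  CrossedProductWf full_norms_bounded full_norm_is_algebra_seminorm.

Let wf := full_crossed_product_exists.

Let iota : Cc G A -> full_crossed_product wf :=
  to_completion (alg_seminorm (full_norm_seminorm wf)).

Lemma exists_Cc_near (x : full_crossed_product wf) (e : R) : 0 < e ->
  exists a, nrm (x - iota a) < e.
Proof. exact: to_completion_dense. Qed.

Section one_form.
Context (d : measure_display) (X : measurableType d) (mu : {measure set X -> \bar R}).
Variables (v : G -> bop (Lp mu p1)) (pi : A -> bop (Lp mu p1)).

(** Sigma-finiteness and nondegeneracy place the norm of the integrated form among those whose
    supremum is [full_norm]; it is therefore contractive and [alg_completion_lift] applies. *)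
Lemma extends_integrated_form_exists : sigma_finite setT mu ->
  contractive_covariant alpha v pi -> nondegenerate_rep pi ->
  exists rho : full_crossed_product wf -> bop (Lp mu p1),
    extends_integrated_form iota v pi rho.
Proof.
move=> sf cov nd.
have [|||rho [hrho nrho rhoE]] := @alg_completion_lift _ _ _ _ (full_norm_seminorm wf) _
    (Lp_form cov) (bop_seq_complete (@Lp_seq_complete _ _ _ mu _ p1)).
- exact: form_op_linear.
- exact: form_op_mul.
- by move=> a; rewrite nrm_bop; exact: le_full_norm.
exists rho; split=> [||a x]; last by rewrite rhoE.
- split=> //; have [lrho _] := hrho.
  by apply: (linear_bound_continuous (M := 1) lrho) => x; rewrite mul1r.
- by move=> x; rewrite !nrmE lecR.
Qed.

Lemma extends_integrated_form_unique (rho rho' : full_crossed_product wf -> bop (Lp mu p1)) :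
  extends_integrated_form iota v pi rho -> extends_integrated_form iota v pi rho' ->
  rho = rho'.
Proof.
move=> [[[lr _] _] cr rE] [[[lr' _] _] cr' rE']; apply/funext => x.
apply/eqP; rewrite -subr_eq0; apply/eqP/nrm0_eq0/le_anti; rewrite nrm_ge0 andbT.
apply/ler_addgt0Pl => e e0; rewrite addr0.
have e2 : 0 < e / 2 by rewrite divr_gt0.
have [a xa] := exists_Cc_near x e2.
have ra : rho (iota a) = rho' (iota a).
  by apply/val_inj/funext => y; rewrite /= rE rE'.
have le_nrm (r : full_crossed_product wf -> bop (Lp mu p1)) y :
    contractive r -> nrm (r y) <= nrm y.
  by move=> /(_ y); rewrite !nrmE lecR.
apply: le_trans (nrm_distD _ (rho (iota a)) _) _; rewrite (splitr e); apply: lerD.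
  by rewrite -(linearfB lr); apply: le_trans (le_nrm _ _ cr) _; exact: ltW.
rewrite ra nrmB -(linearfB lr').
by apply: le_trans (le_nrm _ _ cr') _; exact: ltW.
Qed.

End one_form.

Lemma full_crossed_product_norm (x : full_crossed_product wf) :
  nrm x = sup [set r | exists (d : measure_display)
    (X : measurableType d) (mu : {measure set X -> \bar R})
    (v : G -> bop (Lp mu p1)) (pi : A -> bop (Lp mu p1))
    (rho : full_crossed_product wf -> bop (Lp mu p1)),
    [/\ sigma_finite setT mu, contractive_covariant alpha v pi,
        nondegenerate_rep pi, extends_integrated_form iota v pi rho
      & r = nrm (rho x)]].
Proof.
set S := [set r | _].
have ubS : ubound S (nrm x).
  move=> _ [d [X [mu [v [pi [rho [_ _ _ [_ + _] ->]]]]]]].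
  by move=> /(_ x); rewrite !nrmE lecR.
have hS : has_sup S.
  split; last by exists (nrm x).
  have [sf cov nd] := @zero_representation R p p1 _ (borel G) G A alpha.
  have [rho hrho] := extends_integrated_form_exists sf cov nd.
  by exists (nrm (rho x)), _, (borel G), mzero, (fun=> bop_id _), (fun=> 0), rho; split.
apply/le_anti/andP; split; last by apply: ge_sup => //; case: hS.
apply/ler_addgt0Pl => e e0.
(* Three errors: replacing x by iota a in its norm, choosing a representation almost attaining N a,
   and returning from rho (iota a) to rho x. *)
have e3 : 0 < e / 3 by rewrite divr_gt0.
have [a xa] := exists_Cc_near x e3.
have ia : nrm (iota a) = N a by exact: nrm_to_completion.
have [r [d [X [mu [v [pi [sf cov nd rE]]]]]]  Nr] := sup_adherent e3 (full_norms_bounded a).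
have [rho hrho] := extends_integrated_form_exists sf cov nd.
have [[[lr _] _] cr rE'] := hrho.
have xS : nrm (rho x) <= sup S.
  by apply: ub_le_sup; [case: hS|exists d, X, mu, v, pi, rho; split].
have rhoa : nrm (rho (iota a)) = r.
  rewrite rE nrm_bop; congr opnorm; apply/funext => y; exact: rE'.
have le1 : nrm x <= nrm (x - iota a) + N a by rewrite -ia -{1}(subrK (iota a) x) ler_nrmD.
have le2 : r <= nrm (rho x) + nrm (x - iota a).
  rewrite -rhoa -lerBlDl; apply: le_trans (ler_norm _) _.
  apply: le_trans (nrm_dist _ _) _; rewrite nrmB -(linearfB lr).
  by have := cr (x - iota a); rewrite !nrmE lecR.
rewrite -/(full_norm _ _ _ _) -/N in Nr.
move: le1 le2 xS xa Nr; move: (nrm x) (nrm (x - _)) (nrm (rho x)) (N a) (sup S) => *.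
lra.
Qed.

Lemma iota_mul a b : iota (Cc_mul (convolution_Cc wf) a b) = nmul (iota a) (iota b).
Proof.
rewrite [RHS]completion_mul_pi; congr sep_pi; exact/val_inj.
Qed.

Lemma iota_dense : dense (range iota).
Proof.
move=> O [x Ox] oO; have /nbhs_ballP[e] := open_nbhs_nbhs (conj oO Ox).
rewrite /= ltcE/= => /andP[/eqP ei e0] xeO.
have [a xa] := exists_Cc_near x e0; exists (iota a); split; last by exists a.
apply: xeO; rewrite -ball_normE /ball_/= nrmE ltcE/= ei eqxx/=.
exact: xa.
Qed.

End full_crossed_product.

Theorem theorem3p6 (R : realType) (p : R) (p1 : 1 <= p)
    (G : topologicalGroupType) (G_hausdorff : hausdorff_space G)
    (G_locally_compact : locally_compact [set: G])
    (G_second_countable : @second_countable G)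
    (nu : {measure set (borel G) -> \bar R}) (nu_haar : left_haar nu)
    (A : banachAlgType R[i]) (A_Lp : Lp_operator_algebra p1 A)
    (alpha : G -> A -> A) (alpha_action : isometric_action alpha)
    (A_rep : nondegenerately_sigma_finitely_representable p1 A) :
  exists (wf : crossed_product_wf nu alpha p1)
         (iota : Cc G A -> full_crossed_product wf),
    [/\ linear iota /\
        (forall a b : Cc G A,
           iota (Cc_mul (convolution_Cc wf) a b) = nmul (iota a) (iota b)),
        (forall (d : measure_display) (X : measurableType d)
           (mu : {measure set X -> \bar R})
           (v : G -> bop (Lp mu p1)) (pi : A -> bop (Lp mu p1)),
           sigma_finite setT mu -> contractive_covariant alpha v pi ->
           nondegenerate_rep pi ->
           exists! rho : full_crossed_product wf -> bop (Lp mu p1),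
             extends_integrated_form iota v pi rho),
        (forall x : full_crossed_product wf,
           nrm x = sup [set r | exists (d : measure_display)
             (X : measurableType d) (mu : {measure set X -> \bar R})
             (v : G -> bop (Lp mu p1)) (pi : A -> bop (Lp mu p1))
             (rho : full_crossed_product wf -> bop (Lp mu p1)),
             [/\ sigma_finite setT mu, contractive_covariant alpha v pi,
                 nondegenerate_rep pi, extends_integrated_form iota v pi rho
               & r = nrm (rho x)]])
      & dense (range iota)].
Proof.
pose wf := full_crossed_product_exists p1 G_hausdorff nu_haar alpha_action.
exists wf, (to_completion (alg_seminorm (full_norm_seminorm wf))); split.
- by split; [exact: to_completion_linear|exact: iota_mul].
- move=> d X mu v pi sf cov nd.
  have [rho hrho] := extends_integrated_form_exists G_hausdorff nu_haar alpha_action sf cov nd.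
  by exists rho; split=> // rho' ?; exact: extends_integrated_form_unique hrho _.
- exact: full_crossed_product_norm.
- exact: iota_dense.
Qed.
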